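(* Let $\Omega\subset\mathbb{R}^n$ be a nonempty open bounded convex set satisfying an interior sphere condition, and let $a$ be a real constant. Assume that the unique solution of the Dirichlet problem $-\Delta_\infty u=1$ in $\Omega$, $u=0$ on $\partial\Omega$, is of class $C^1$ on $\{x\in\overline\Omega:\operatorname{dist}(x,\partial\Omega)<\delta\}$ for some $\delta>0$. Further, assume that there exists an inner ball $B\subset\Omega$ of radius $\rho_\Omega$ whose boundary meets $\partial\Omega$ at two points lying on the same diameter of $B$. If the overdetermined boundary value problem $$-\Delta_\infty u=1\ \text{in }\Omega,\qquad u=0\ \text{on }\partial\Omega,\qquad|\nabla u|=a\ \text{on }\partial\Omega$$ admits a solution $u$, then $u=\phi_\Omega$ (with $\rho_\Omega=a^3/3$), and $\overline\Sigma(\Omega)=\mathrm M(\Omega)$.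
   Context: For smooth $\varphi$, $\Delta_\infty\varphi:=\langle\nabla^2\varphi\,\nabla\varphi,\nabla\varphi\rangle$. A solution to the Dirichlet problem is a function $u\in C(\overline\Omega)$ with $u=0$ on $\partial\Omega$ which is a viscosity solution of $-\Delta_\infty u=1$ in $\Omega$, i.e. for every $x_0\in\Omega$ and $\varphi\in C^2(\Omega)$: if $u-\varphi$ has a local maximum at $x_0$ then $-\Delta_\infty\varphi(x_0)-1\le 0$, and if $u-\varphi$ has a local minimum at $x_0$ then $-\Delta_\infty\varphi(x_0)-1\ge 0$. The solution is known to exist and be unique. The overdetermined problem admits a solution if this unique solution $u$ is of class $C^1$ up to the boundary near $\partial\Omega$ (in the sense stated in the claim) and $|\nabla u|=a$ on $\partial\Omega$. Interior sphere condition: every point of $\partial\Omega$ lies on the boundary of some open ball contained in $\Omega$. $d_{\partial\Omega}$ is the distance to $\partial\Omega$; $\rho_\Omega:=\max_{\overline\Omega}d_{\partial\Omega}$ is the inradius. $\Sigma(\Omega)$ is the set of points of $\Omega$ where $d_{\partial\Omega}$ is not differentiable; the cut locus $\overline\Sigma(\Omega)$ is the closure of $\Sigma(\Omega)$ in $\overline\Omega$; the high ridge is $\mathrm M(\Omega):=\{x\in\Omega:d_{\partial\Omega}(x)=\rho_\Omega\}$. The web function is $\phi_\Omega(x):=c_0[\rho_\Omega^{4/3}-(\rho_\Omega-d_{\partial\Omega}(x))^{4/3}]$ with $c_0:=3^{4/3}/4$. *)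

(* Defs.v *)
(* Points of R^n are row vectors in 'rV[R]_n. *)
From HB Require Import structures.
From mathcomp Require Import all_boot all_order all_algebra.
From mathcomp Require Import all_classical all_reals all_analysis.

Set Implicit Arguments.
Unset Strict Implicit.
Unset Printing Implicit Defensive.

Import Order.TTheory GRing.Theory Num.Theory.
Import numFieldNormedType.Exports.

Local Open Scope classical_set_scope.
Local Open Scope ring_scope.

(* The library norm `|x| on 'rV[R]_n is the max norm. It is equivalent to the
   Euclidean one, so the library's topology, boundedness and differentiability
   are the usual ones; everything metric below uses [enorm]. *)
Definition enorm (R : realType) (n : nat) (x : 'rV[R]_n) : R :=
  Num.sqrt (\sum_i x 0 i ^+ 2).

Definition eball (R : realType) (n : nat) (c : 'rV[R]_n) (r : R) :
    set 'rV[R]_n :=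
  [set x | enorm (x - c) < r].

Definition boundary (R : realType) (n : nat) (Omega : set 'rV[R]_n) :
    set 'rV[R]_n :=
  closure Omega `\` interior Omega.

Definition partial (R : realType) (n : nat) (i : 'I_n) (f : 'rV[R]_n -> R) :
    'rV[R]_n -> R :=
  fun x => 'D_(delta_mx 0 i) f x.

Definition grad (R : realType) (n : nat) (f : 'rV[R]_n -> R) (x : 'rV[R]_n) :
    'rV[R]_n :=
  \row_i partial i f x.

Definition hess (R : realType) (n : nat) (f : 'rV[R]_n -> R) (x : 'rV[R]_n) :
    'M[R]_n :=
  \matrix_(i, j) partial j (partial i f) x.

Definition inf_laplacian (R : realType) (n : nat) (f : 'rV[R]_n -> R)
    (x : 'rV[R]_n) : R :=
  (grad f x *m hess f x *m (grad f x)^T) 0 0.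

(* Meant for open sets: derivatives are taken in the ambient space. *)
Definition C1_on (R : realType) (n : nat) (Omega : set 'rV[R]_n)
    (f : 'rV[R]_n -> R) : Prop :=
  forall x, Omega x -> differentiable f x /\ {for x, continuous (grad f)}.

Definition C2_on (R : realType) (n : nat) (Omega : set 'rV[R]_n)
    (f : 'rV[R]_n -> R) : Prop :=
  C1_on Omega f /\ forall i, C1_on Omega (partial i f).

Definition local_max (R : realType) (n : nat) (f : 'rV[R]_n -> R)
    (x0 : 'rV[R]_n) : Prop :=
  \forall x \near x0, f x <= f x0.

Definition local_min (R : realType) (n : nat) (f : 'rV[R]_n -> R)
    (x0 : 'rV[R]_n) : Prop :=
  \forall x \near x0, f x0 <= f x.

Definition viscosity_solution (R : realType) (n : nat) (Omega : set 'rV[R]_n)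
    (u : 'rV[R]_n -> R) : Prop :=
  forall (x0 : 'rV[R]_n) (phi : 'rV[R]_n -> R), Omega x0 -> C2_on Omega phi ->
    (local_max (fun x => u x - phi x) x0 -> - inf_laplacian phi x0 - 1 <= 0) /\
    (local_min (fun x => u x - phi x) x0 -> 0 <= - inf_laplacian phi x0 - 1).

Definition dirichlet_solution (R : realType) (n : nat) (Omega : set 'rV[R]_n)
    (u : 'rV[R]_n -> R) : Prop :=
  [/\ {within closure Omega, continuous u},
      forall x, boundary Omega x -> u x = 0
    & viscosity_solution Omega u].

Definition dist_boundary (R : realType) (n : nat) (Omega : set 'rV[R]_n)
    (x : 'rV[R]_n) : R :=
  inf [set enorm (x - y) | y in boundary Omega].

Definition collar (R : realType) (n : nat) (Omega : set 'rV[R]_n) (delta : R) :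
    set 'rV[R]_n :=
  [set x | closure Omega x /\ dist_boundary Omega x < delta].

(* u is C^1 on the collar, up to the boundary: the gradient of u in the part of
   the collar inside the open set Omega extends continuously to the whole
   collar. G is this extension; it is unique on the collar, whose boundary
   points are limits of interior ones, and gives the meaning of the gradient of
   u on the boundary. *)
Definition C1_up_to_boundary (R : realType) (n : nat) (Omega : set 'rV[R]_n)
    (delta : R) (u : 'rV[R]_n -> R) (G : 'rV[R]_n -> 'rV[R]_n) : Prop :=
  (forall x, Omega x -> dist_boundary Omega x < delta ->
     differentiable u x /\ G x = grad u x) /\
  {within collar Omega delta, continuous G}.

Definition interior_sphere_condition (R : realType) (n : nat)
    (Omega : set 'rV[R]_n) : Prop :=
  forall p, boundary Omega p ->
    exists c r, [/\ 0 < r, eball c r `<=` Omega & enorm (p - c) = r].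

(* The supremum is a maximum when Omega is nonempty and bounded. *)
Definition inradius (R : realType) (n : nat) (Omega : set 'rV[R]_n) : R :=
  sup [set dist_boundary Omega x | x in closure Omega].

Definition singular_set (R : realType) (n : nat) (Omega : set 'rV[R]_n) :
    set 'rV[R]_n :=
  [set x | Omega x /\ ~ differentiable (dist_boundary Omega) x].

Definition cut_locus (R : realType) (n : nat) (Omega : set 'rV[R]_n) :
    set 'rV[R]_n :=
  closure (singular_set Omega) `&` closure Omega.

Definition high_ridge (R : realType) (n : nat) (Omega : set 'rV[R]_n) :
    set 'rV[R]_n :=
  [set x | Omega x /\ dist_boundary Omega x = inradius Omega].

(* On the closure of Omega both bases are nonnegative, and 0 `^ (4 / 3) = 0. *)
Definition web_function (R : realType) (n : nat) (Omega : set 'rV[R]_n)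
    (x : 'rV[R]_n) : R :=
  (3 `^ (4 / 3) / 4) *
  (inradius Omega `^ (4 / 3) -
   (inradius Omega - dist_boundary Omega x) `^ (4 / 3)).

(* Main.v *)
(* Idea.  Write rho for the inradius, c0 = 3^(4/3)/4 and d for the distance to
   the boundary.  For every boundary point y the function
   c0 (rho^(4/3) - (rho - |x - y|)^(4/3)) is a radial solution off y, so
   comparison yields u <= c0 (rho^(4/3) - (rho - d)^(4/3)), once one knows that
   max u <= c0 rho^(4/3); a larger maximum would be the tip of a cone lying
   above u, which a steep parabola rules out.  Comparison from below with the
   radial caps centred at z gives u >= c0 (d(z)^(4/3) - |x - z|^(4/3)).
   On the segment from the centre of the inner ball to its contact point both
   bounds agree, hence a^3 = 3 rho.  Comparing u from above with an increasing
   radial function centred at a point x0 close to y in the boundary, where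
   |grad u| is nearly a, produces points at distance nearly rho from y where u
   is nearly c0 rho^(4/3).  In the limit, every boundary point y sees a point z
   with |z - y| = d(z) = rho.  By convexity z lies on the inner normal ray
   through every point whose nearest boundary point is y, and the cap centred
   at z then gives the missing lower bound and, d being squeezed between
   rho - |x - z| and |x - y|, its differentiability where d < rho. *)
Require Import Defs.
From HB Require Import structures.
From mathcomp Require Import all_boot all_order all_algebra.
From mathcomp Require Import all_classical all_reals all_analysis.
From mathcomp Require Import ring lra.

Import Order.TTheory GRing.Theory Num.Theory.
Import numFieldNormedType.Exports.

Local Open Scope classical_set_scope.
Local Open Scope ring_scope.

Set Implicit Arguments.
Unset Strict Implicit.
Unset Printing Implicit Defensive.

(** * Cube roots and Euclidean geometry *)

Section CubeRoot.
Context {R : realType}.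
Implicit Types x y : R.

(* [cbrt], hence [pow43], vanishes on the negative numbers: this keeps the
   radial functions below continuous, and constant beyond their radius. *)
Fact cbrt_key : unit. Proof. by []. Qed.
Definition cbrt := locked_with cbrt_key (fun x : R => Num.max 0 x `^ 3^-1).

Lemma cbrtE x : cbrt x = Num.max 0 x `^ 3^-1.
Proof. by rewrite /cbrt locked_withE. Qed.

Lemma cbrt_ge0 x : 0 <= cbrt x. Proof. by rewrite cbrtE powR_ge0. Qed.

Lemma cbrtK x : 0 <= x -> cbrt x ^+ 3 = x.
Proof.
move=> x0; rewrite cbrtE (max_idPr x0) -powR_mulrn ?powR_ge0 // -powRrM mulVf //.
exact: powRr1.
Qed.

Lemma le_cbrt : {homo @cbrt : x y / x <= y}.
Proof.
move=> x y xy; rewrite !cbrtE; apply: ge0_ler_powR => //.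
- by rewrite nnegrE le_max lexx.
- by rewrite nnegrE le_max lexx.
- by rewrite ge_max le_max lexx /= le_max xy orbT.
Qed.

Lemma cbrt_le0 x : x <= 0 -> cbrt x = 0.
Proof. by move=> x0; rewrite cbrtE (max_idPl x0) powR0. Qed.

Lemma cbrt_gt0 x : 0 < x -> 0 < cbrt x.
Proof. by move=> x0; rewrite cbrtE powR_gt0 // lt_max x0 orbT. Qed.

Lemma exprK_cbrt y : 0 <= y -> cbrt (y ^+ 3) = y.
Proof.
move=> y0; apply/eqP; rewrite -(@eqrXn2 _ 3) ?cbrt_ge0 //.
by rewrite cbrtK // exprn_ge0.
Qed.

Lemma lt_cbrt x y : 0 < y -> x < y -> cbrt x < cbrt y.
Proof.
move=> y0 xy; rewrite lt_neqAle le_cbrt ?ltW // andbT.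
apply/eqP => E; have [x0|x0] := leP 0 x.
  by move: xy; rewrite -(cbrtK x0) E cbrtK ?ltW // ltxx.
by move: (cbrt_gt0 y0); rewrite -E cbrt_le0 ?ltW // ltxx.
Qed.

Lemma powR43E x : 0 <= x -> x `^ (4 / 3) = cbrt x ^+ 4.
Proof.
move=> x0; rewrite cbrtE (max_idPr x0) -[RHS]powR_mulrn ?powR_ge0 //.
by rewrite -powRrM mulrC.
Qed.

(** For cube roots [0 <= s <= t], [t^3 - s^3 - (t - s)^3 = 3 s t (t - s) >= 0]. This Hoelder bound
    yields the continuity of [cbrt]. *)
Lemma cbrt_dist x y : x <= y -> (cbrt y - cbrt x) ^+ 3 <= y - x.
Proof.
move=> xy; have [y0|y0] := leP y 0.
  by rewrite (cbrt_le0 y0) (cbrt_le0 (le_trans xy y0)) subr0 expr0n /= subr_ge0.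
have := le_cbrt xy; have := cbrtK (ltW y0); have := cbrt_ge0 x.
have [x0|x0] := leP 0 x; last first.
  by rewrite (cbrt_le0 (ltW x0)) subr0 => _ -> _; lra.
have := cbrtK x0; move: (cbrt x) (cbrt y) => s t <- s0 <- st.
have : 0 <= s * t * (t - s) by rewrite !mulr_ge0 // ?subr_ge0 //; lra.
nra.
Qed.

Lemma continuous_cbrt : continuous (@cbrt).
Proof.
move=> x; apply/(@cvgrPdist_le _ R^o) => /= e e0.
have e3 : 0 < e ^+ 3 by rewrite exprn_gt0.
near=> t.
have xt : `|x - t| <= e ^+ 3.
  by near: t; apply: cvgr_dist_le.
rewrite -(@ler_pXn2r _ 3) ?nnegrE ?normr_ge0 ?(ltW e0) //.
apply: le_trans xt; have [tx|xt] := leP t x.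
  rewrite ger0_norm ?subr_ge0 ?le_cbrt //.
  by apply: le_trans (cbrt_dist tx) _; exact: ler_norm.
rewrite distrC ger0_norm; last by rewrite subr_ge0 le_cbrt // ltW.
by apply: le_trans (cbrt_dist (ltW xt)) _; rewrite distrC ler_norm.
Unshelve. all: by end_near. Qed.

Fact pow43_key : unit. Proof. by []. Qed.
(** The power [4/3] of the positive part, written through the cube root so that its inequalities
    become polynomial ones in [cbrt x]. *)
Definition pow43 := locked_with pow43_key (fun x => cbrt x ^+ 4).

Lemma pow43E x : pow43 x = cbrt x ^+ 4.
Proof. by rewrite /pow43 locked_withE. Qed.

Lemma cvgXn (T : Type) (F : set_system T) {FF : Filter F} (f : T -> R) (a : R) n :
  f @ F --> a -> f x ^+ n @[x --> F] --> a ^+ n.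
Proof. by move=> fa; exact: (cvg_comp _ _ fa (@exprn_continuous R n a)). Qed.

Lemma continuous_pow43 : continuous pow43.
Proof.
rewrite (_ : pow43 = fun x => cbrt x ^+ 4); last by apply/funext => x; exact: pow43E.
by move=> x; apply: cvgXn; exact: continuous_cbrt.
Qed.

Lemma pow43_ge0 x : 0 <= pow43 x.
Proof. by rewrite pow43E exprn_ge0 // cbrt_ge0. Qed.

Lemma pow43_0 : pow43 0 = 0.
Proof. by rewrite pow43E cbrt_le0 // expr0n. Qed.

Lemma pow43_gt0 x : 0 < x -> 0 < pow43 x.
Proof. by move=> x0; rewrite pow43E exprn_gt0 // cbrt_gt0. Qed.

Lemma le_pow43 : {homo pow43 : x y / x <= y}.
Proof.
by move=> x y xy; rewrite !pow43E ler_pXn2r ?nnegrE ?cbrt_ge0 ?le_cbrt.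
Qed.

Lemma lt_pow43_inv x y : pow43 x < pow43 y -> x < y.
Proof. by move=> xy; rewrite ltNge; apply: contraL xy => /le_pow43; rewrite -leNgt. Qed.

(** Convexity of the power [4/3], whose derivative is [4/3 cbrt x]. In the cube roots the gap is
    [(t - s)^2] times a nonnegative quadratic form. *)
Lemma pow43_tangent x y : 0 <= x -> 0 <= y ->
  4 / 3 * cbrt x * (y - x) <= pow43 y - pow43 x.
Proof.
move=> x0 y0; rewrite !pow43E; have := cbrt_ge0 x; have := cbrt_ge0 y.
have := cbrtK x0; have := cbrtK y0; move: (cbrt x) (cbrt y) => s t <- <- s0 t0.
rewrite -subr_ge0.
have -> : t ^+ 4 - s ^+ 4 - 4 / 3 * s * (t ^+ 3 - s ^+ 3) =
  1 / 3 * (t - s) ^+ 2 * (3 * t ^+ 2 + 2 * (t * s) + s ^+ 2) by field.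
apply: mulr_ge0; first by rewrite mulr_ge0 ?sqr_ge0.
have := mulr_ge0 t0 s0; have := sqr_ge0 t; have := sqr_ge0 s; lra.
Qed.

(* Second-order Taylor bounds for x^(4/3): writing x = s^3 and y = t^3,
   the first-order remainder is (t - s)^2 (3 t^2 + 2 s t + s^2) / 3. *)
Lemma pow43_taylor_le x m : 0 < x -> 4 / (9 * cbrt x ^+ 2) < m ->
  \forall y \near x,
    pow43 y - pow43 x <= 4 / 3 * cbrt x * (y - x) + m / 2 * (y - x) ^+ 2.
Proof.
move=> x0 hm; have s0 := cbrt_gt0 x0.
(* With [y = t^3], the right side minus the left side is [(t - cbrt x)^2 * Q t]. The assumption on
   [m], compared with the second derivative [4/9 x^(-2/3)], says that [Q] is positive at [cbrt x],
   hence nearby by continuity. *)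
pose Q (t : R) : R := m / 2 * (t ^+ 2 + t * cbrt x + cbrt x ^+ 2) ^+ 2 -
  1 / 3 * (3 * t ^+ 2 + 2 * (t * cbrt x) + cbrt x ^+ 2).
have cQ : Q (cbrt t) @[t --> x] --> Q (cbrt x).
  have ct := @continuous_cbrt x.
  apply: cvgB; apply: cvgM; try exact: cvg_cst.
    apply: cvgXn; apply: cvgD; last exact: cvg_cst.
    by apply: cvgD; [exact: cvgXn|apply: cvgM => //; exact: cvg_cst].
  apply: cvgD; last exact: cvg_cst.
  by apply: cvgD; apply: cvgM; try exact: cvg_cst; [exact: cvgXn|apply: cvgM => //; exact: cvg_cst].
have Q0 : 0 < Q (cbrt x).
  have -> : Q (cbrt x) = 9 / 2 * cbrt x ^+ 4 * (m - 4 / (9 * cbrt x ^+ 2)).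
    by rewrite /Q; field; rewrite gt_eqF.
  by rewrite mulr_gt0 ?subr_gt0 // mulr_gt0 ?exprn_gt0.
near=> y.
have y0 : 0 < y by near: y; apply: lt_nbhsr.
have Qy : 0 < Q (cbrt y) by near: y; apply: (cvgr_gt _ cQ).
rewrite -subr_ge0; move: Qy; rewrite /Q !pow43E.
move: (cbrt x) (cbrtK (ltW x0)) (cbrt y) (cbrtK (ltW y0)) => s <- t <- Qy.
have -> : 4 / 3 * s * (t ^+ 3 - s ^+ 3) + m / 2 * (t ^+ 3 - s ^+ 3) ^+ 2 -
  (t ^+ 4 - s ^+ 4) = (t - s) ^+ 2 * (m / 2 * (t ^+ 2 + t * s + s ^+ 2) ^+ 2 -
  1 / 3 * (3 * t ^+ 2 + 2 * (t * s) + s ^+ 2)) by field.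
by rewrite mulr_ge0 ?sqr_ge0 // ltW.
Unshelve. all: by end_near. Qed.

Lemma pow43_taylor_ge x m : 0 < x -> m < 4 / (9 * cbrt x ^+ 2) ->
  \forall y \near x,
    4 / 3 * cbrt x * (y - x) + m / 2 * (y - x) ^+ 2 <= pow43 y - pow43 x.
Proof.
move=> x0 hm; have s0 := cbrt_gt0 x0.
pose Q (t : R) : R := 1 / 3 * (3 * t ^+ 2 + 2 * (t * cbrt x) + cbrt x ^+ 2) -
  m / 2 * (t ^+ 2 + t * cbrt x + cbrt x ^+ 2) ^+ 2.
have cQ : Q (cbrt t) @[t --> x] --> Q (cbrt x).
  have ct := @continuous_cbrt x.
  apply: cvgB; apply: cvgM; try exact: cvg_cst.
    apply: cvgD; last exact: cvg_cst.
    apply: cvgD; apply: cvgM; try exact: cvg_cst; first exact: cvgXn.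
    by apply: cvgM => //; exact: cvg_cst.
  apply: cvgXn; apply: cvgD; last exact: cvg_cst.
  by apply: cvgD; [exact: cvgXn|apply: cvgM => //; exact: cvg_cst].
have Q0 : 0 < Q (cbrt x).
  have -> : Q (cbrt x) = 9 / 2 * cbrt x ^+ 4 * (4 / (9 * cbrt x ^+ 2) - m).
    by rewrite /Q; field; rewrite gt_eqF.
  by rewrite mulr_gt0 ?subr_gt0 // mulr_gt0 ?exprn_gt0.
near=> y.
have y0 : 0 < y by near: y; apply: lt_nbhsr.
have Qy : 0 < Q (cbrt y) by near: y; apply: (cvgr_gt _ cQ).
rewrite -subr_ge0; move: Qy; rewrite /Q !pow43E.
move: (cbrt x) (cbrtK (ltW x0)) (cbrt y) (cbrtK (ltW y0)) => s <- t <- Qy.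
have -> : t ^+ 4 - s ^+ 4 -
  (4 / 3 * s * (t ^+ 3 - s ^+ 3) + m / 2 * (t ^+ 3 - s ^+ 3) ^+ 2) =
  (t - s) ^+ 2 * (1 / 3 * (3 * t ^+ 2 + 2 * (t * s) + s ^+ 2) -
  m / 2 * (t ^+ 2 + t * s + s ^+ 2) ^+ 2) by field.
by rewrite mulr_ge0 ?sqr_ge0 // ltW.
Unshelve. all: by end_near. Qed.

End CubeRoot.

(** * The Euclidean inner product and norm, compared with the max norm *)

Section Euclid.
Context {R : realType} {n : nat}.
Implicit Types (x y z v w e : 'rV[R]_n) (a b : R).

Definition dot x y : R := \sum_i x 0 i * y 0 i.

Lemma dotC x y : dot x y = dot y x.
Proof. by apply: eq_bigr => i _; rewrite mulrC. Qed.

Lemma dotDl x y z : dot (x + y) z = dot x z + dot y z.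
Proof. by rewrite -big_split /=; apply: eq_bigr => i _; rewrite mxE mulrDl. Qed.

Lemma dotZl a x y : dot (a *: x) y = a * dot x y.
Proof. by rewrite mulr_sumr; apply: eq_bigr => i _; rewrite mxE mulrA. Qed.

Lemma dotNl x y : dot (- x) y = - dot x y.
Proof. by rewrite -scaleN1r dotZl mulN1r. Qed.

Lemma dotDr x y z : dot x (y + z) = dot x y + dot x z.
Proof. by rewrite dotC dotDl !(dotC x). Qed.

Lemma dotZr a x y : dot x (a *: y) = a * dot x y.
Proof. by rewrite dotC dotZl dotC. Qed.

Lemma dotNr x y : dot x (- y) = - dot x y.
Proof. by rewrite dotC dotNl dotC. Qed.

Definition dotE := (dotDl, dotDr, dotNl, dotNr, dotZl, dotZr).

Lemma dot_deltar x (i : 'I_n) : dot x (delta_mx 0 i) = x 0 i.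
Proof.
rewrite /dot (bigD1 i) //= big1 ?addr0 => [|j ji]; first by rewrite mxE !eqxx mulr1.
by rewrite mxE (negbTE ji) andbF mulr0.
Qed.

Lemma dotxx_ge0 x : 0 <= dot x x.
Proof. by apply: sumr_ge0 => i _; rewrite -expr2 sqr_ge0. Qed.

Lemma sqr_enorm x : enorm x ^+ 2 = dot x x.
Proof.
rewrite sqr_sqrtr; first by apply: eq_bigr => i _; rewrite expr2.
by apply: sumr_ge0 => i _; rewrite sqr_ge0.
Qed.

Lemma enorm_ge0 x : 0 <= enorm x. Proof. exact: sqrtr_ge0. Qed.

Lemma enorm0 : enorm (0 : 'rV[R]_n) = 0.
Proof. by rewrite /enorm big1 ?sqrtr0 // => i _; rewrite mxE expr0n. Qed.

Lemma enorm_coord x i : `|x 0 i| <= enorm x.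
Proof.
rewrite -(@ler_pXn2r _ 2) ?nnegrE ?enorm_ge0 // sqr_enorm real_normK ?num_real //.
rewrite /dot (bigD1 i) //= -expr2 lerDl; apply: sumr_ge0 => j _.
by rewrite -expr2 sqr_ge0.
Qed.

Lemma enorm_eq0 x : enorm x = 0 -> x = 0.
Proof.
move=> x0; apply/rowP => i; rewrite mxE; apply/eqP.
by rewrite -normr_le0 -x0 enorm_coord.
Qed.

Lemma enorm_gt0 x : (0 < enorm x) = (x != 0).
Proof.
rewrite lt_def enorm_ge0 andbT; congr (~~ _); apply/eqP/eqP; first exact: enorm_eq0.
by move=> ->; exact: enorm0.
Qed.

Lemma enormZ a x : enorm (a *: x) = `|a| * enorm x.
Proof.
apply/eqP; rewrite -(@eqrXn2 _ 2) ?mulr_ge0 ?enorm_ge0 //.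
by rewrite exprMn !sqr_enorm dotZl dotZr real_normK ?num_real // mulrA -expr2.
Qed.

Lemma enormN x : enorm (- x) = enorm x.
Proof. by rewrite -scaleN1r enormZ normrN1 mul1r. Qed.

Lemma enormB x y : enorm (x - y) = enorm (y - x).
Proof. by rewrite -opprB enormN. Qed.

Lemma dot_le x y : dot x y <= enorm x * enorm y.
Proof.
have [->|x0] := eqVneq x 0.
  by rewrite enorm0 mul0r /dot big1 // => i _; rewrite mxE mul0r.
have [->|y0] := eqVneq y 0.
  by rewrite enorm0 mulr0 /dot big1 // => i _; rewrite mxE mulr0.
have : 0 <= dot (enorm y *: x - enorm x *: y) (enorm y *: x - enorm x *: y).
  exact: dotxx_ge0.
rewrite !dotE -!sqr_enorm (dotC y x).
have := enorm_gt0 x; have := enorm_gt0 y; rewrite x0 y0.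
move: (enorm x) (enorm y) (dot x y) => s t d t0 s0 H.
have : 0 <= 2 * (s * t) * (s * t - d) by lra.
by rewrite pmulr_rge0 ?subr_ge0 // !mulr_gt0.
Qed.

Lemma dot_norm_le x y : `|dot x y| <= enorm x * enorm y.
Proof. by rewrite ler_norml dot_le andbT lerNl -dotNl -(enormN x) dot_le. Qed.

Lemma enormD x y : enorm (x + y) <= enorm x + enorm y.
Proof.
rewrite -(@ler_pXn2r _ 2) ?nnegrE ?addr_ge0 ?enorm_ge0 //.
rewrite sqrrD !sqr_enorm !dotE (dotC y x).
have := dot_le x y; lra.
Qed.

Lemma enorm_le_mx x : enorm x <= n%:R * `|x|.
Proof.
apply: (@le_trans _ _ (\sum_i `|x 0 i|)).
  rewrite -(@ler_pXn2r _ 2) ?nnegrE ?enorm_ge0 ?sumr_ge0 //.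
  rewrite sqr_enorm expr2 mulr_suml; apply: ler_sum => i _.
  apply: (@le_trans _ _ (`|x 0 i| * `|x 0 i|)).
    by rewrite -normrM ler_norm.
  rewrite ler_wpM2l // (bigD1 i) //= lerDl; exact: sumr_ge0.
apply: (@le_trans _ _ (\sum_(i < n) `|x|)).
  apply: ler_sum => i _; rewrite [leRHS]/Num.norm /= mx_normrE.
  by apply/bigmax_geP; right => /=; exists (0, i).
by rewrite sumr_const card_ord mulr_natl.
Qed.

Lemma mx_le_enorm x : `|x| <= enorm x.
Proof.
rewrite [leLHS]/Num.norm /= mx_normrE; apply/bigmax_leP; split; first exact: enorm_ge0.
by case=> i j _ /=; rewrite ord1 enorm_coord.
Qed.

Lemma enorm_dist x y : `|enorm x - enorm y| <= enorm (x - y).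
Proof.
have H u v : enorm u - enorm v <= enorm (u - v) by rewrite lerBlDr -{1}(subrK v u) enormD.
by rewrite ler_norml H andbT lerNl opprB enormB H.
Qed.

Lemma nbhs_enormP x (A : set 'rV[R]_n) :
  nbhs x A <-> exists2 r, 0 < r & forall y, enorm (y - x) < r -> A y.
Proof.
split=> [/nbhs_ballP[r /= r0 rA]|[r r0 rA]].
  exists r => // y yr; apply: rA; rewrite -ball_normE /= distrC.
  exact: le_lt_trans (mx_le_enorm _) yr.
(* The factor between the two norms is at most [n]; [n.+1] keeps the radius positive when
   [n = 0]. *)
apply/nbhs_ballP; exists (r / n.+1%:R) => /= [|y]; first by rewrite divr_gt0.
rewrite -ball_normE /= distrC ltr_pdivlMr ?ltr0n // => yr; apply: rA.
apply: le_lt_trans (enorm_le_mx _) _; apply: le_lt_trans yr.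
by rewrite mulrC ler_wpM2l // ler_nat.
Qed.

Lemma continuous_enormP (f : 'rV[R]_n -> R) x : {for x, continuous f} <->
  forall eps, 0 < eps ->
    exists2 r, 0 < r & forall y, enorm (y - x) < r -> `|f y - f x| <= eps.
Proof.
have P := @cvgrPdist_le _ _ _ _ (nbhs_filter x) f (f x).
split=> [/P H eps eps0|H]; first have /nbhs_enormP[r r0 rP] := H _ eps0.
  by exists r => // y /rP; rewrite distrC.
apply/P => eps /H[r r0 rP]; apply/nbhs_enormP; exists r => // y /rP.
by rewrite distrC.
Qed.

Lemma continuous_enorm : continuous (@enorm R n).
Proof.
move=> x; apply/continuous_enormP => e e0; exists e => // y yx.
by rewrite (le_trans (enorm_dist _ _)) // ltW.
Qed.

Lemma continuous_dotl e : continuous (dot^~ e).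
Proof.
move=> x; apply/continuous_enormP => eps eps0.
have e0 : 0 < enorm e + 1 by rewrite ltr_wpDl ?enorm_ge0.
exists (eps / (enorm e + 1)); rewrite ?divr_gt0 // => y yx.
rewrite -dotNl -dotDl (le_trans (dot_norm_le _ _)) //.
rewrite (@le_trans _ _ (enorm (y - x) * (enorm e + 1))) //.
  by rewrite ler_wpM2l ?enorm_ge0 // lerDl.
by rewrite -ler_pdivlMr // ltW.
Qed.

End Euclid.

(** * Quadratic test functions *)

Section Differential.
Context {R : realType} {n : nat}.
Implicit Types (f : 'rV[R]_n -> R) (x y v w e : 'rV[R]_n).

Lemma dot_linear w : exists L : {linear 'rV[R]_n -> R^o}, L = dot^~ w :> (_ -> _).
Proof.
have lin : linear (dot^~ w : 'rV[R]_n -> R^o) by move=> a u v; rewrite dotDl dotZl.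
pose L : {linear 'rV[R]_n -> R^o} := HB.pack (dot^~ w : 'rV[R]_n -> R^o)
  (GRing.isLinear.Build R 'rV[R]_n R^o _ _ lin).
by exists L.
Qed.

(** The little-o criterion in Euclidean form; uniqueness of the differential then identifies every
    directional derivative. *)
Lemma diff_enormP f x w :
  (forall eps, 0 < eps -> exists2 r, 0 < r &
    forall v, enorm v < r -> `|f (x + v) - f x - dot v w| <= eps * enorm v) ->
  differentiable f x /\ forall v, 'D_v f x = dot v w.
Proof.
move=> H; have [L LE] := dot_linear w.
have cL : continuous L by rewrite LE; exact: continuous_dotl.
pose g : 'rV[R]_n -> R^o := f.
have E := proj2 (@eqaddoP R 'rV[R]_n R^o 'rV[R]_n (nbhs_filter_on (0 : 'rV[R]_n))
  (g \o shift x) (cst (g x) + (L : 'rV[R]_n -> R^o)) id).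
move: E; match goal with |- (?P -> _) -> _ => assert (H1 : P) end.
  move=> eps eps0.
  have eps1 : 0 < eps / n.+1%:R by rewrite divr_gt0.
  have [r r0 rP] := H _ eps1.
  apply/nbhs_enormP; exists r => // v; rewrite subr0 => vr.
  rewrite /= /g !fctE LE opprD addrA /= [v + x]addrC.
  apply: (le_trans (rP _ vr)); rewrite mulrAC ler_pdivrMr ?ltr0n // -mulrA.
  rewrite ler_wpM2l ?(ltW eps0) // mulrC; apply: le_trans (enorm_le_mx v) _.
  by rewrite ler_wpM2r // ler_nat.
move=> /(_ H1) E; have dL := diff_unique cL E.
have df : differentiable g x.
  apply/diff_locallyP; rewrite dL; split => //.
by split=> // v; rewrite deriveE // dL LE.
Qed.

Lemma diff_sqr f x w C r : 0 < r ->
  (forall v, enorm v < r -> `|f (x + v) - f x - dot v w| <= C * enorm v ^+ 2) ->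
  differentiable f x /\ forall v, 'D_v f x = dot v w.
Proof.
move=> r0 H; apply: diff_enormP => eps eps0.
have C0 : 0 < `|C| + 1 by rewrite ltr_wpDl.
exists (Num.min r (eps / (`|C| + 1))); first by rewrite lt_min r0 divr_gt0.
move=> v; rewrite lt_min => /andP[/H vr].
rewrite ltr_pdivlMr // => /ltW v1; apply: (le_trans vr).
rewrite expr2 mulrA ler_wpM2r ?enorm_ge0 // mulrC; apply: le_trans v1.
rewrite ler_wpM2l ?enorm_ge0 // (le_trans (ler_norm _)) // lerDl //.
Qed.

Lemma grad_eq f x w : (forall v, 'D_v f x = dot v w) -> grad f x = w.
Proof.
by move=> H; apply/rowP => i; rewrite mxE /partial H dotC dot_deltar.
Qed.

Lemma derive_grad f x v : differentiable f x -> 'D_v f x = dot v (grad f x).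
Proof.
move=> df; rewrite deriveE // {1}[v]row_sum_delta linear_sum /dot.
by apply: eq_bigr => i _; rewrite linearZ /= mxE /partial deriveE.
Qed.

Lemma derive_approx f x v eps : differentiable f x -> 0 < eps ->
  exists2 r, 0 < r & forall h, h != 0 -> `|h| < r ->
    `|(f (x + h *: v) - f x) / h - 'D_v f x| <= eps.
Proof.
move=> df eps0; have dv : derivable f x v by exact: diff_derivable.
have /cvgrPdist_le/(_ eps eps0) : h^-1 *: ((f \o shift x) (h *: v) - f x)
  @[h --> 0^'] --> 'D_v f x by exact: dv.
move=> [r /= r0 rP]; exists r => // h h0 hr.
have := rP h; rewrite /= sub0r normrN hr h0 distrC => /(_ isT isT).
by rewrite [h *: v + x]addrC mulrC.
Qed.

Lemma derive_ge f x v a r : 0 < r -> differentiable f x ->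
  (forall h, 0 < h -> h < r -> a * h <= f (x + h *: v) - f x) -> a <= 'D_v f x.
Proof.
move=> r0 df H; apply/ler_addgt0Pr => eps eps0.
have [r' r'0 H'] := derive_approx v df eps0.
pose h := Num.min r r' / 2.
have m0 : 0 < Num.min r r' by rewrite lt_min r0.
have h0 : 0 < h by rewrite divr_gt0.
have hm : h < Num.min r r' by rewrite /h ltr_pdivrMr // mulr_natr mulr2n ltrDl.
move: (hm); rewrite lt_min => /andP[hr hr'].
have := H _ h0 hr; rewrite -ler_pdivlMr // => /le_trans; apply.
have := H' h; rewrite gt_eqF // gtr0_norm // => /(_ isT hr').
by rewrite ler_distl => /andP[].
Qed.

Lemma derive_le f x v a r : 0 < r -> differentiable f x ->
  (forall h, 0 < h -> h < r -> f (x + h *: v) - f x <= a * h) -> 'D_v f x <= a.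
Proof.
move=> r0 df H; apply/ler_addgt0Pr => eps eps0.
have [r' r'0 H'] := derive_approx v df eps0.
pose h := Num.min r r' / 2.
have m0 : 0 < Num.min r r' by rewrite lt_min r0.
have h0 : 0 < h by rewrite divr_gt0.
have hm : h < Num.min r r' by rewrite /h ltr_pdivrMr // mulr_natr mulr2n ltrDl.
move: (hm); rewrite lt_min => /andP[hr hr'].
have := H _ h0 hr; rewrite -ler_pdivrMr // => H1.
have := H' h; rewrite gt_eqF // gtr0_norm // => /(_ isT hr').
rewrite ler_distl => /andP[H2 _]; lra.
Qed.

End Differential.

(** * Quadratic polynomials and the viscosity inequalities *)

Section TestFunction.
Context {R : realType} {n : nat}.
Implicit Types (x y v e : 'rV[R]_n) (p m K : R).

(* For a unit vector [e], the quadratic polynomial at [x0] with gradient [p e]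
   and Hessian [m] along [e] and [2 K] across. *)
Definition quad x0 e p m K x : R :=
  p * dot (x - x0) e + m / 2 * dot (x - x0) e ^+ 2 +
  K * (dot (x - x0) (x - x0) - dot (x - x0) e ^+ 2).

Let gquad x0 e p m K x : 'rV[R]_n :=
  (p + (m - 2 * K) * dot (x - x0) e) *: e + (2 * K) *: (x - x0).

Lemma quad_diff x0 e p m K x : differentiable (quad x0 e p m K) x /\
  forall v, 'D_v (quad x0 e p m K) x = dot v (gquad x0 e p m K x).
Proof.
(* The first-order remainder is exactly [(m/2 - K) <v,e>^2 + K |v|^2], which [C |v|^2] bounds. *)
pose C := `|m / 2 - K| * enorm e ^+ 2 + `|K|.
apply: (@diff_sqr R n _ x _ C 1) => // v _.
have -> : quad x0 e p m K (x + v) - quad x0 e p m K x - dot v (gquad x0 e p m K x) =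
  (m / 2 - K) * dot v e ^+ 2 + K * enorm v ^+ 2.
  rewrite /quad /gquad sqr_enorm [x + v - x0]addrAC.
  by move: (x - x0) => y; rewrite !dotE (dotC v y); field.
apply: (le_trans (ler_normD _ _)); rewrite /C [leRHS]mulrDl lerD //.
  rewrite normrM -mulrA ler_wpM2l // normrX -exprMn.
  by rewrite lerXn2r ?nnegrE ?mulr_ge0 ?enorm_ge0 // mulrC dot_norm_le.
by rewrite normrM ler_wpM2l // ger0_norm // sqr_ge0.
Qed.

Lemma grad_quad x0 e p m K : grad (quad x0 e p m K) = gquad x0 e p m K.
Proof. by apply/funext => x; apply: grad_eq; have [] := quad_diff x0 e p m K x. Qed.

Lemma partial_quad x0 e p m K i :
  partial i (quad x0 e p m K) = fun x => gquad x0 e p m K x 0 i.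
Proof. by apply/funext => x; rewrite -grad_quad mxE. Qed.

Lemma partial_quad_diff x0 e p m K i x :
  differentiable (partial i (quad x0 e p m K)) x /\
  forall v, 'D_v (partial i (quad x0 e p m K)) x =
    dot v (((m - 2 * K) * e 0 i) *: e + (2 * K) *: delta_mx 0 i).
Proof.
rewrite partial_quad; apply: (@diff_sqr R n _ x _ 0 1) => // v _.
rewrite mul0r normr_le0 !dotE dot_deltar /gquad !mxE !dotE; apply/eqP; ring.
Qed.

Lemma grad_partial_quad x0 e p m K i :
  grad (partial i (quad x0 e p m K)) =
  cst (((m - 2 * K) * e 0 i) *: e + (2 * K) *: delta_mx 0 i).
Proof.
by apply/funext => x; apply: grad_eq; have [] := partial_quad_diff x0 e p m K i x.
Qed.

Lemma C2_quad Omega x0 e p m K : C2_on Omega (quad x0 e p m K).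
Proof.
split=> [x _|i x _].
  split; first by have [] := quad_diff x0 e p m K x.
  have cB : {for x, continuous (fun z : 'rV[R]_n => z - x0)}.
    exact: (@continuousB _ _ _ id (cst x0) x (@cvg_id _ (nbhs x)) (@cst_continuous _ _ _ _)).
  have cd : {for x, continuous (fun z : 'rV[R]_n => dot (z - x0) e)}.
    exact: (@continuous_comp _ _ _ (fun z : 'rV[R]_n => z - x0) (dot^~ e) x cB
      (@continuous_dotl _ _ _ _)).
  have cM := continuousM (@cst_continuous 'rV[R]_n R (m - 2 * K) x) cd.
  have cF : {for x, continuous (fun z : 'rV[R]_n => (p + (m - 2 * K) * dot (z - x0) e) *: e)}.
    exact: (continuousZr_tmp (continuousD (@cst_continuous 'rV[R]_n R^o p x) cM)).
  have cG : {for x, continuous (fun z : 'rV[R]_n => (2 * K) *: (z - x0))}.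
    exact: (continuousZl_tmp cB).
  by rewrite grad_quad; exact: (continuousD cF cG).
split; first by have [] := partial_quad_diff x0 e p m K i x.
by rewrite grad_partial_quad; exact: cst_continuous.
Qed.

(** At [x0] the gradient [p e] is an eigenvector of the Hessian with eigenvalue [m]. This leaves [K]
    free to absorb transversal errors. *)
Lemma inf_laplacian_quad x0 e p m K : enorm e = 1 ->
  inf_laplacian (quad x0 e p m K) x0 = p ^+ 2 * m.
Proof.
move=> e1; have ee : dot e e = 1 by rewrite -sqr_enorm e1 expr1n.
have gE : grad (quad x0 e p m K) x0 = p *: e.
  rewrite grad_quad /gquad subrr /dot big1 => [|i _]; last by rewrite mxE mul0r.
  by rewrite mulr0 addr0 scaler0 addr0.
have hE : grad (quad x0 e p m K) x0 *m hess (quad x0 e p m K) x0 = (p * m) *: e.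
  rewrite gE; apply/rowP => j; rewrite !mxE.
  under eq_bigr => i _.
    rewrite !mxE /partial (partial_quad_diff x0 e p m K i x0).2.
    rewrite !dotE [dot (delta_mx 0 j) e]dotC !dot_deltar !mxE eqxx /=.
    rewrite (_ : _ * _ = (p * (m - 2 * K) * e 0 j) * (e 0 i * e 0 i) +
      (2 * K * p) * (e 0 i * (i == j)%:R)); last first.
      ring.
    over.
  rewrite big_split /= -!mulr_sumr -/(dot e e) ee.
  rewrite (bigD1 j) //= big1 ?addr0 => [|i /negbTE ->]; last by rewrite mulr0.
  rewrite eqxx /=; ring.
rewrite /inf_laplacian hE gE mxE.
under eq_bigr => i _ do rewrite !mxE mulrACA.
by rewrite -mulr_sumr -/(dot e e) ee; ring.
Qed.

(** This lemma and the next are the only access to the viscosity inequalities: every test function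
    below is a [quad]. *)
Lemma viscosity_max Omega (u : 'rV[R]_n -> R) x0 e p m K :
  viscosity_solution Omega u -> Omega x0 -> enorm e = 1 ->
  (\forall x \near x0, u x <= u x0 + quad x0 e p m K x) -> - (p ^+ 2 * m) <= 1.
Proof.
move=> uv Ox0 e1 H.
have [+ _] := uv x0 (quad x0 e p m K) Ox0 (@C2_quad _ _ _ _ _ _).
rewrite inf_laplacian_quad // subr_le0; apply.
have q0 : quad x0 e p m K x0 = 0.
  have d0 y : dot 0 y = 0 by rewrite /dot big1 // => i _; rewrite mxE mul0r.
  by rewrite /quad subrr !d0; ring.
by apply: filterS H => x; rewrite q0 subr0 lerBlDr.
Qed.

Lemma viscosity_min Omega (u : 'rV[R]_n -> R) x0 e p m K :
  viscosity_solution Omega u -> Omega x0 -> enorm e = 1 ->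
  (\forall x \near x0, u x0 + quad x0 e p m K x <= u x) -> 1 <= - (p ^+ 2 * m).
Proof.
move=> uv Ox0 e1 H.
have [_ +] := uv x0 (quad x0 e p m K) Ox0 (@C2_quad _ _ _ _ _ _).
rewrite inf_laplacian_quad // subr_ge0; apply.
have q0 : quad x0 e p m K x0 = 0.
  have d0 y : dot 0 y = 0 by rewrite /dot big1 // => i _; rewrite mxE mul0r.
  by rewrite /quad subrr !d0; ring.
by apply: filterS H => x; rewrite q0 subr0 lerBrDr.
Qed.

End TestFunction.

(** * Contact with radial functions *)

Section Contact.
Context {R : realType} {n : nat}.
Implicit Types (Omega : set 'rV[R]_n) (u : 'rV[R]_n -> R) (x y z e : 'rV[R]_n).
Implicit Types (k r p m K : R).

Definition dir x z : 'rV[R]_n := (enorm (x - z))^-1 *: (x - z).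

Lemma enorm_dir x z : 0 < enorm (x - z) -> enorm (dir x z) = 1.
Proof. by move=> r0; rewrite enormZ gtr0_norm ?invr_gt0 // mulVf ?gt_eqF. Qed.

Lemma dirK x z : 0 < enorm (x - z) -> enorm (x - z) *: dir x z = x - z.
Proof. by move=> r0; rewrite scalerA divff ?gt_eqF // scale1r. Qed.

Lemma dot_unit_bound y e : enorm e = 1 -> `|dot y e| <= enorm y.
Proof. by move=> e1; rewrite (le_trans (dot_norm_le _ _)) // e1 mulr1. Qed.

Lemma dot_unit_sqr y e : enorm e = 1 -> dot y e ^+ 2 <= dot y y.
Proof.
move=> e1; rewrite -sqr_enorm -(real_normK (num_real (dot y e))).
by rewrite lerXn2r ?nnegrE ?enorm_ge0 ?dot_unit_bound.
Qed.

(* Second-order upper bound for the distance to [z] around [x0]: exact along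
   the direction [x0 - z], quadratic across. *)
Lemma enorm_expand z x0 x (r0 := enorm (x0 - z)) (e := dir x0 z) : 0 < r0 ->
  enorm (x - x0) <= r0 / 2 ->
  enorm (x - z) <= r0 + dot (x - x0) e +
    (dot (x - x0) (x - x0) - dot (x - x0) e ^+ 2) / r0.
Proof.
move=> r00 xr; have e1 : enorm e = 1 by exact: enorm_dir.
have eK : r0 *: e = x0 - z by exact: dirK.
move: e e1 eK => e e1 eK.
have sb := dot_unit_bound (x - x0) e1; have b0 := dot_unit_sqr (x - x0) e1.
have E : enorm (x - z) ^+ 2 =
    (r0 + dot (x - x0) e) ^+ 2 + (dot (x - x0) (x - x0) - dot (x - x0) e ^+ 2).
  have -> : x - z = (x - x0) + r0 *: e by rewrite eK addrA subrK.
  move: (x - x0) => y; rewrite sqr_enorm !dotE -!sqr_enorm e1 (dotC e); ring.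
move: b0 sb E; set s := dot _ e; set d := dot _ _ => b0.
rewrite ler_norml => /andP[s1 s2] E.
have q0 : 0 <= (d - s ^+ 2) / r0 by rewrite divr_ge0 ?subr_ge0 // ltW.
(* With [q = (d - s^2)/r0], the square of the right side exceeds that of the left by
   [2 q (r0 + s - r0/2) + q^2]; this bound makes it nonnegative. *)
have t0 : r0 / 2 <= r0 + s by lra.
rewrite -(@ler_pXn2r _ 2) ?nnegrE ?enorm_ge0 //; last by lra.
rewrite E [leRHS]sqrrD -subr_ge0.
have -> : (r0 + s) ^+ 2 + (r0 + s) * ((d - s ^+ 2) / r0) *+ 2 +
   ((d - s ^+ 2) / r0) ^+ 2 - ((r0 + s) ^+ 2 + (d - s ^+ 2)) =
   2 * ((d - s ^+ 2) / r0) * (r0 + s - r0 / 2) + ((d - s ^+ 2) / r0) ^+ 2.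
  by field; rewrite gt_eqF.
apply: addr_ge0; last exact: sqr_ge0.
by apply: mulr_ge0; [exact: mulr_ge0|rewrite subr_ge0].
Qed.

(** Coordinates for the contact arguments: [s] is the radial displacement, [b] the squared
    transversal one, and [t] bounds the increase of the distance to [z]. *)
Lemma enorm_expand_near z x0 delta (r0 := enorm (x0 - z)) (e := dir x0 z) :
  0 < r0 -> 0 < delta ->
  \forall x \near x0, exists s b t,
    [/\ s = dot (x - x0) e, b = dot (x - x0) (x - x0) - s ^+ 2,
        t = s + b / r0, enorm (x - z) <= r0 + t &
        [/\ `|t| < delta, 0 <= b, b <= 1 & `|s| <= 1]].
Proof.
(* Within [r0/2] the expansion is valid and [b/r0 <= |x - x0|], so that
   [|t| <= 2 |x - x0| < delta]. *)
move=> r00 d0; pose rho := Num.min (r0 / 2) (Num.min 1 (delta / 2)).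
apply/nbhs_enormP; exists rho; first by rewrite !lt_min !divr_gt0 ?ltr01.
move=> x; rewrite !lt_min => /and3P[x1 x2 x3].
have e1 : enorm e = 1 by exact: enorm_dir.
have sb := dot_unit_bound (x - x0) e1; have b0 := dot_unit_sqr (x - x0) e1.
exists (dot (x - x0) e), (dot (x - x0) (x - x0) - dot (x - x0) e ^+ 2),
  (dot (x - x0) e + (dot (x - x0) (x - x0) - dot (x - x0) e ^+ 2) / r0).
have d1 : dot (x - x0) (x - x0) - dot (x - x0) e ^+ 2 <= enorm (x - x0) ^+ 2.
  by rewrite sqr_enorm gerBl sqr_ge0.
have y0 := enorm_ge0 (x - x0).
split=> //; first by rewrite addrA enorm_expand // ltW.
split=> //.
- apply: le_lt_trans (ler_normD _ _) _.
  rewrite [X in _ + X]ger0_norm ?divr_ge0 ?subr_ge0 ?(ltW r00) //.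
  have : (dot (x - x0) (x - x0) - dot (x - x0) e ^+ 2) / r0 <= enorm (x - x0).
    rewrite ler_pdivrMr //; apply: (le_trans d1); rewrite expr2 ler_wpM2l //.
    lra.
  lra.
- by rewrite subr_ge0.
- by apply: (le_trans d1); rewrite exprn_ile1 // ltW.
- by apply: (le_trans sb); rewrite ltW.
Qed.

(** Off the centre the infinity Laplacian of [k |x|^(4/3)] is [64/81 k^3], so [81/64] is the
    critical value of [k^3]. Here and in the next lemma the factor [l] shifts the second derivative
    strictly, as the Taylor bounds require, without crossing the critical value. *)
Lemma cube_le1 k : 0 < k -> 81 / 64 < k ^+ 3 ->
  exists2 l, l < 1 & 1 < l * (64 / 81 * k ^+ 3).
Proof.
move=> k0 hk; set q := k ^+ 3 in hk *; have q0 : 0 < q by lra.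
exists ((1 + 81 / (64 * q)) / 2).
  have : 81 / (64 * q) < 1 by rewrite ltr_pdivrMr ?mulr_gt0 //; lra.
  lra.
have -> : (1 + 81 / (64 * q)) / 2 * (64 / 81 * q) = (64 / 81 * q + 1) / 2.
  by field; rewrite gt_eqF.
lra.
Qed.

Lemma cube_ge1 k : 0 < k -> k ^+ 3 < 81 / 64 ->
  exists2 l, 1 < l & l * (64 / 81 * k ^+ 3) < 1.
Proof.
move=> k0 hk; have : 0 < k ^+ 3 by rewrite exprn_gt0.
set q := k ^+ 3 in hk * => q0.
exists ((1 + 81 / (64 * q)) / 2).
  have : 1 < 81 / (64 * q) by rewrite ltr_pdivlMr ?mulr_gt0 //; lra.
  lra.
have -> : (1 + 81 / (64 * q)) / 2 * (64 / 81 * q) = (64 / 81 * q + 1) / 2.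
  by field; rewrite gt_eqF.
lra.
Qed.

(** As a function of [x], [- k (rr - |x - z|)^(4/3)] has [-Delta_infty = 64/81 k^3 > 1] where
    [0 < |x - z| < rr], so a subsolution cannot touch it from below. The test is made with a
    quadratic lying above it. *)
Lemma no_contact_above Omega u x0 z k rr :
  viscosity_solution Omega u -> Omega x0 -> 0 < k -> 81 / 64 < k ^+ 3 ->
  0 < enorm (x0 - z) -> enorm (x0 - z) < rr ->
  ~ (\forall x \near x0, u x <=
      u x0 + k * (pow43 (rr - enorm (x0 - z)) - pow43 (rr - enorm (x - z)))).
Proof.
move=> uv Ox0 k0 hk r00 r0R H.
pose r0 := enorm (x0 - z); pose W := rr - r0.
have W0 : 0 < W by rewrite subr_gt0.
have y00 := cbrt_gt0 W0; pose y0 := cbrt W.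
have [l l1 lk] := cube_le1 k0 hk.
have l0 : 0 < l.
  have q0 : 0 < 64 / 81 * k ^+ 3 by rewrite mulr_gt0 ?exprn_gt0.
  by rewrite -(pmulr_lgt0 _ q0) (lt_trans _ lk).
have c0 : 0 < 4 / (9 * y0 ^+ 2) by rewrite divr_gt0 // mulr_gt0 // exprn_gt0.
pose m := l * (4 / (9 * y0 ^+ 2)).
have hm : m < 4 / (9 * y0 ^+ 2) by rewrite /m gtr_pMl.
have m0 : 0 < m by rewrite mulr_gt0.
have /nbhs_ballP[del /= del0 Hdel] := pow43_taylor_ge W0 hm.
pose p := 4 / 3 * k * y0; have p0 : 0 < p by rewrite !mulr_gt0.
(* The transversal coefficient pays for the part [p b/r0] of [p t] and for the cross term
   [k m s b/r0] of [k m t^2 / 2], as [|s| <= 1]. *)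
have := @viscosity_max _ _ _ u x0 (dir x0 z) p (- (k * m)) ((p + k * m) / r0) uv Ox0
  (enorm_dir r00).
have near_quad : \forall x \near x0,
    u x <= u x0 + quad x0 (dir x0 z) p (- (k * m)) ((p + k * m) / r0) x.
  have N := enorm_expand_near r00 del0.
  apply: filterS2 H N => x ux [s [b [t [sE bE tE xz [td b0 b1 s1]]]]].
  apply: (le_trans ux); rewrite lerD2l /quad -sE -bE.
  have : ball W del (W - t) by rewrite /ball /= opprB addrC subrK.
  move=> /Hdel; rewrite [W - t - W]addrAC subrr add0r sqrrN => Tay.
  have mon : pow43 (W - t) <= pow43 (rr - enorm (x - z)).
    apply: le_pow43; rewrite /W /r0; lra.
  apply: (@le_trans _ _ (k * (4 / 3 * y0 * t - m / 2 * t ^+ 2))).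
    rewrite ler_pM2l //; move: Tay mon; rewrite -/y0 -/W mulrN; lra.
  have q0 : 0 <= b / r0 by rewrite divr_ge0 // ltW.
  have km : 0 < k * m by rewrite mulr_gt0.
  rewrite -subr_ge0.
  have -> : p * s + - (k * m) / 2 * s ^+ 2 + (p + k * m) / r0 * b -
    k * (4 / 3 * y0 * t - m / 2 * t ^+ 2) =
    k * m * (b / r0) * (1 + s) + k * m / 2 * (b / r0) ^+ 2.
    by rewrite tE -/r0 /p; field; rewrite gt_eqF.
  move: s1; rewrite ler_norml => /andP[s1 _].
  apply: addr_ge0; apply: mulr_ge0.
  - by rewrite mulr_ge0 // ltW.
  - lra.
  - by rewrite divr_ge0 // ltW.
  - exact: sqr_ge0.
move=> /(_ near_quad); rewrite mulrN opprK leNgt => /negP; apply.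
have -> // : p ^+ 2 * (k * m) = l * (64 / 81 * k ^+ 3).
by rewrite /p /m; field; rewrite gt_eqF.
Qed.

Let below_identity (k y s b r m : R) : r != 0 ->
  - (k * (4 / 3 * y * (s + b / r) + m / 2 * (s + b / r) ^+ 2)) -
  (- (4 / 3 * k * y) * s + - (k * m) / 2 * s ^+ 2 +
   - (4 / 3 * k * y / r + k * m / 2 * (2 / r + 1 / r ^+ 2)) * b) =
  k * m * (b / r) * (1 - s) + k * m / 2 * (b * (1 - b) / r ^+ 2).
Proof. by move=> r0; field. Qed.

(** Off [z] the function [- k |x - z|^(4/3)] has [-Delta_infty = 64/81 k^3 < 1], so a supersolution
    cannot touch it from above. *)
Lemma no_contact_below Omega u x0 z k :
  viscosity_solution Omega u -> Omega x0 -> 0 < k -> k ^+ 3 < 81 / 64 ->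
  0 < enorm (x0 - z) ->
  ~ (\forall x \near x0,
      u x0 - k * (pow43 (enorm (x - z)) - pow43 (enorm (x0 - z))) <= u x).
Proof.
move=> uv Ox0 k0 hk r00 H.
pose r0 := enorm (x0 - z).
have y00 := cbrt_gt0 r00; pose y0 := cbrt r0.
have [l l1 lk] := cube_ge1 k0 hk.
have c0 : 0 < 4 / (9 * y0 ^+ 2) by rewrite divr_gt0 // mulr_gt0 // exprn_gt0.
pose m := l * (4 / (9 * y0 ^+ 2)).
have hm : 4 / (9 * y0 ^+ 2) < m by rewrite /m ltr_pMl.
have m0 : 0 < m by rewrite (lt_trans c0).
have /nbhs_ballP[del /= del0 Hdel] := pow43_taylor_le r00 hm.
pose p := 4 / 3 * k * y0; have p0 : 0 < p by rewrite !mulr_gt0.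
(* Besides the terms linear in [b/r0], the square [(b/r0)^2] has to be absorbed here; [b <= 1]
   bounds it by [b/r0^2]. *)
pose K := p / r0 + k * m / 2 * (2 / r0 + 1 / r0 ^+ 2).
have := @viscosity_min _ _ _ u x0 (dir x0 z) (- p) (- (k * m)) (- K) uv Ox0
  (enorm_dir r00).
have near_quad : \forall x \near x0,
    u x0 + quad x0 (dir x0 z) (- p) (- (k * m)) (- K) x <= u x.
  have N := enorm_expand_near r00 del0.
  apply: filterS2 H N => x ux [s [b [t [sE bE tE xz [td b0 b1 s1]]]]].
  apply: le_trans ux; rewrite lerD2l /quad -sE -bE.
  have : ball r0 del (r0 + t) by rewrite /ball /= opprD addrA subrr sub0r normrN.
  move=> /Hdel; rewrite [r0 + t - r0]addrAC subrr add0r => Tay.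
  have mon : pow43 (enorm (x - z)) <= pow43 (r0 + t) by exact: le_pow43.
  apply: (@le_trans _ _ (- (k * (4 / 3 * y0 * t + m / 2 * t ^+ 2)))); last first.
    by rewrite lerN2 ler_pM2l //; move: Tay mon; rewrite -/y0 -/r0; lra.
  have q0 : 0 <= b / r0 by rewrite divr_ge0 // ltW.
  have km : 0 < k * m by rewrite mulr_gt0.
  rewrite -subr_ge0.
  have -> : - (k * (4 / 3 * y0 * t + m / 2 * t ^+ 2)) -
    (- p * s + - (k * m) / 2 * s ^+ 2 + - K * b) =
    k * m * (b / r0) * (1 - s) + k * m / 2 * (b * (1 - b) / r0 ^+ 2).
    by rewrite tE; apply: below_identity; rewrite gt_eqF.
  move: s1; rewrite ler_norml => /andP[_ s1].
  apply: addr_ge0; apply: mulr_ge0.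
  - by rewrite mulr_ge0 // ltW.
  - lra.
  - by rewrite divr_ge0 // ltW.
  - by rewrite divr_ge0 ?sqr_ge0 // mulr_ge0 // subr_ge0.
move=> /(_ near_quad); rewrite mulrN opprK sqrrN leNgt => /negP; apply.
have -> // : p ^+ 2 * (k * m) = l * (64 / 81 * k ^+ 3).
by rewrite /p /m; field; rewrite gt_eqF.
Qed.

End Contact.

(** * Distance to the boundary *)

Section Compactness.
Context {R : realType} {n : nat}.
Implicit Types (A K : set 'rV[R]_n) (u h : 'rV[R]_n -> R) (x y z : 'rV[R]_n).

Lemma compact_enorm A M : closed A -> (forall x, A x -> enorm x <= M) -> compact A.
Proof.
move=> cA AM; apply: bounded_closed_compact => //.
exists M; split; first exact: num_real.
move=> M' MM' x Ax /=; apply: le_trans (mx_le_enorm x) _.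
by apply: le_trans (AM _ Ax) _; exact: ltW.
Qed.

Lemma continuous_enormB z : continuous (fun x : 'rV[R]_n => enorm (x - z)).
Proof.
move=> x; apply/continuous_enormP => e e0; exists e => // y yx.
by apply: (le_trans (enorm_dist _ _)); rewrite opprB addrA subrK ltW.
Qed.

Lemma closed_enorm_le z r : closed [set x : 'rV[R]_n | enorm (x - z) <= r].
Proof.
rewrite (_ : [set x | _] = (fun x : 'rV[R]_n => enorm (x - z)) @^-1` [set r' | r' <= r]) //.
apply: closed_comp; last exact: closed_le.
by move=> x _; exact: continuous_enormB.
Qed.

Lemma within_max K u h : K !=set0 -> compact K -> {within K, continuous u} ->
  continuous h -> exists2 x0, K x0 & forall x, K x -> u x + h x <= u x0 + h x0.
Proof.
move=> K0 cK cu ch; have cs : {within K, continuous (u \+ h)}.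
  by move=> x; apply: cvgD; [exact: cu|exact: continuous_subspaceT].
have [c Kc H] := EVT_max_rV K0 cK cs.
by exists c => [|x Kx]; [rewrite inE in Kc|apply: H; rewrite inE].
Qed.

Lemma within_min K u h : K !=set0 -> compact K -> {within K, continuous u} ->
  continuous h -> exists2 x0, K x0 & forall x, K x -> u x0 + h x0 <= u x + h x.
Proof.
move=> K0 cK cu ch; have cs : {within K, continuous (u \+ h)}.
  by move=> x; apply: cvgD; [exact: cu|exact: continuous_subspaceT].
have [c Kc H] := EVT_min_rV K0 cK cs.
by exists c => [|x Kx]; [rewrite inE in Kc|apply: H; rewrite inE].
Qed.

End Compactness.

(** * The distance to the boundary of a bounded open set *)

Section DistanceToBoundary.
Context {R : realType} {n : nat} (Omega : set 'rV[R]_n).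
Context (Omega_open : open Omega) (Omega_bounded : bounded_set Omega).
Context (boundary0 : boundary Omega !=set0).
Implicit Types (x y z : 'rV[R]_n) (r : R).

Local Notation d := (dist_boundary Omega).

Lemma boundaryP x : boundary Omega x <-> closure Omega x /\ ~ Omega x.
Proof. by rewrite /boundary (proj1 (interior_id Omega) Omega_open). Qed.

Lemma boundary_notin x : boundary Omega x -> ~ Omega x.
Proof. by move=> /boundaryP[]. Qed.

Lemma boundary_closure x : boundary Omega x -> closure Omega x.
Proof. by case. Qed.

Lemma closure_cases x : closure Omega x -> Omega x \/ boundary Omega x.
Proof.
by move=> cx; have [Ox|Ox] := pselect (Omega x); [left|right; apply/boundaryP].
Qed.

Lemma closure_enorm x :
  closure Omega x <-> forall r, 0 < r -> exists2 y, Omega y & enorm (y - x) < r.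
Proof.
split=> [cx r r0|H B /nbhs_enormP[r r0 rB]].
  have /cx[y [Oy By]] : nbhs x [set y | enorm (y - x) < r].
    by apply/nbhs_enormP; exists r.
  by exists y.
by have [y Oy yx] := H _ r0; exists y; split => //; exact: rB.
Qed.

Lemma open_enorm x : Omega x ->
  exists2 r, 0 < r & forall y, enorm (y - x) < r -> Omega y.
Proof.
by move=> Ox; apply/nbhs_enormP; exact: open_nbhs_nbhs.
Qed.

Lemma closure_bounded : exists M, forall x, closure Omega x -> enorm x <= M.
Proof.
have [M [_ HM]] := Omega_bounded.
have H x : Omega x -> `|x| <= M + 1 by apply: HM; rewrite ltrDl.
exists (n%:R * (M + 1)) => x cx; apply/ler_addgt0Pr => e e0.
have [y Oy yx] := (closure_enorm x).1 cx e e0.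
rewrite -(subrK y x) addrC (le_trans (enormD _ _)) // enormB lerD //; last first.
  by rewrite enormB enormB ltW.
by rewrite (le_trans (enorm_le_mx y)) // ler_wpM2l // H.
Qed.

Lemma compact_in_closure (K : set 'rV[R]_n) :
  closed K -> K `<=` closure Omega -> compact K.
Proof.
move=> cK KO; have [M HM] := closure_bounded.
by apply: (compact_enorm cK) => x /KO; exact: HM.
Qed.

Lemma closed_boundary : closed (boundary Omega).
Proof.
rewrite /boundary setDE; apply: closedI; first exact: closed_closure.
by apply: open_closedC; exact: open_interior.
Qed.

Lemma nearest_boundary x :
  exists y, [/\ boundary Omega y, d x = enorm (x - y) &
    forall y', boundary Omega y' -> enorm (x - y) <= enorm (x - y')].
Proof.
have cb : compact (boundary Omega).
  by apply: compact_in_closure; [exact: closed_boundary|move=> y []].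
have c0 : {within boundary Omega, continuous (cst (0 : R))}.
  by apply: continuous_subspaceT => y; exact: cst_continuous.
have [y By Hy] := within_min boundary0 cb c0 (@continuous_enormB R n x).
have H y' : boundary Omega y' -> enorm (x - y) <= enorm (x - y').
  by move=> /Hy; rewrite !add0r !(enormB _ x).
exists y; split => //; apply/eqP; rewrite eq_le; apply/andP; split.
  by apply: ge_inf; [exists (enorm (x - y)) => _ [y' /H] + <-|exists y].
by apply: lb_le_inf; [exists (enorm (x - y)), y|move=> _ [y' /H] + <-].
Qed.

Lemma dist_le x y : boundary Omega y -> d x <= enorm (x - y).
Proof. by have [y' [_ -> H]] := nearest_boundary x; exact: H. Qed.

Lemma dist_ge x r : (forall y, boundary Omega y -> r <= enorm (x - y)) -> r <= d x.
Proof. by move=> H; have [y' [/H ? -> _]] := nearest_boundary x. Qed.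

Lemma dist_ge0 x : 0 <= d x.
Proof. by apply: dist_ge => y _; exact: enorm_ge0. Qed.

Lemma dist_lip x z : d x <= d z + enorm (x - z).
Proof.
have [y [By -> _]] := nearest_boundary z.
apply: (le_trans (dist_le x By)).
by have := enormD (x - z) (z - y); rewrite addrA subrK [leRHS]addrC.
Qed.

Lemma continuous_dist : continuous d.
Proof.
move=> x; apply/continuous_enormP => e e0; exists e => // y yx.
have := dist_lip x y; have := dist_lip y x; rewrite ler_norml (enormB x y); lra.
Qed.

Lemma dist_boundary0 x : boundary Omega x -> d x = 0.
Proof.
move=> Bx; apply/eqP; rewrite eq_le dist_ge0 andbT.
by apply: (le_trans (dist_le x Bx)); rewrite subrr enorm0.
Qed.

Lemma dist_gt0 x : Omega x -> 0 < d x.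
Proof.
move=> Ox; have [y [By -> _]] := nearest_boundary x.
rewrite enorm_gt0 subr_eq0; apply/eqP => E.
by apply: (boundary_notin By); rewrite -E.
Qed.

(** Otherwise the complement has a point [p] nearest to [x] at distance less than [d x]. Points
    slightly closer to [x] lie in [Omega], so [p] is a boundary point, which is too close. *)
Lemma ball_dist_subset x z : Omega x -> enorm (z - x) < d x -> Omega z.
Proof.
move=> Ox zx; apply: contrapT => NOz.
pose K := ~` Omega `&` [set w | enorm (w - x) <= enorm (z - x)].
have clK : closed K.
  by apply: closedI; [exact: open_closedC|exact: closed_enorm_le].
have cK : compact K.
  apply: (@compact_enorm R n K (enorm (z - x) + enorm x)) => // w [_ /= wx].
  by rewrite -(subrK x w) (le_trans (enormD _ _)) // lerD.
have K0 : K !=set0 by exists z; split => //=.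
have c0 : {within K, continuous (cst (0 : R))}.
  by apply: continuous_subspaceT => y; exact: cst_continuous.
have [p [NOp /= px] Hp] := within_min K0 cK c0 (@continuous_enormB R n x).
suff Bp : boundary Omega p.
  by have := dist_le x Bp; rewrite enormB leNgt (le_lt_trans px).
apply/boundaryP; split => //; apply/closure_enorm => r r0.
have p0 : 0 < enorm (p - x).
  by rewrite enorm_gt0 subr_eq0; apply/eqP => E; apply: NOp; rewrite E.
(* A step from [p] towards [x] of length below [r] that does not overshoot [x]. *)
pose t := Num.min 1 (r / (2 * enorm (p - x))).
have t0 : 0 < t by rewrite lt_min ltr01 divr_gt0 // mulr_gt0.
have t1 : t <= 1 by rewrite ge_min lexx.
have tr : t * enorm (p - x) < r.
  have : t <= r / (2 * enorm (p - x)) by rewrite ge_min lexx orbT.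
  rewrite ler_pdivlMr ?mulr_gt0 //; have := mulr_gt0 t0 p0; lra.
exists (p - t *: (p - x)); last first.
  by rewrite addrAC subrr sub0r enormN enormZ gtr0_norm.
apply: contrapT => NO; have := Hp (p - t *: (p - x)).
rewrite !add0r.
have -> : p - t *: (p - x) - x = (1 - t) *: (p - x).
  by rewrite scalerBl scale1r addrAC.
rewrite enormZ ger0_norm ?subr_ge0 // => H.
have : enorm (p - x) <= (1 - t) * enorm (p - x).
  apply: H; split=> //=.
  have -> : p - t *: (p - x) - x = (1 - t) *: (p - x).
    by rewrite scalerBl scale1r addrAC.
  rewrite enormZ ger0_norm ?subr_ge0 //; apply: le_trans px.
  by rewrite ler_piMl ?enorm_ge0 // gerBl ltW.
have := mulr_gt0 t0 p0; lra.
Qed.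

Lemma dist_le_inradius x : closure Omega x -> d x <= inradius Omega.
Proof.
move=> cx; apply: ub_le_sup; last by exists x.
have [M HM] := closure_bounded; have [y By] := boundary0.
exists (M + enorm y) => _ [z cz <-]; apply: (le_trans (dist_le z By)).
by rewrite (le_trans (enormD _ _)) // enormN lerD // HM.
Qed.

Lemma inradius_gt0 : Omega !=set0 -> 0 < inradius Omega.
Proof.
move=> [x Ox]; apply: lt_le_trans (dist_gt0 Ox) _.
by apply: dist_le_inradius; exact: subset_closure.
Qed.

End DistanceToBoundary.

(** * Comparison of the solution with radial functions *)

Section WebConstant.
Context {R : realType}.
Implicit Types a b k : R.

(* The constant [c_0] of the web function. *)
Definition webc : R := 3 `^ (4 / 3) / 4.

Lemma webcE : webc = 3 / 4 * cbrt 3.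
Proof.
rewrite /webc powR43E //; have := @cbrtK R 3 (ler0n _ _).
by rewrite [_ ^+ 4]exprS => ->; field.
Qed.

Lemma webc_gt0 : 0 < webc.
Proof. by rewrite webcE mulr_gt0 ?cbrt_gt0. Qed.

Lemma webc3 : webc ^+ 3 = 81 / 64.
Proof. by rewrite webcE exprMn cbrtK ?ler0n //; field. Qed.

Lemma gt_webc k : webc < k -> 81 / 64 < k ^+ 3.
Proof.
move=> h; rewrite -webc3 ltr_pXn2r // nnegrE ltW ?webc_gt0 //.
exact: lt_trans webc_gt0 h.
Qed.

Lemma lt_webc k : 0 < k -> k < webc -> k ^+ 3 < 81 / 64.
Proof. by move=> k0 h; rewrite -webc3 ltr_pXn2r // nnegrE ltW ?webc_gt0. Qed.

(** With constant exactly [webc] the radial functions solve the equation, and strict comparison is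
    lost. This lemma and the next carry estimates for [k > webc] and [k < webc] to the limit. *)
Lemma le_webc_lim a b : 0 <= b -> (forall k, webc < k -> a <= k * b) -> a <= webc * b.
Proof.
move=> b0 H; apply/ler_addgt0Pr => e e0.
have b1 : 0 < b + 1 by lra.
have e1 : 0 < e / (b + 1) by rewrite divr_gt0.
apply: (le_trans (H (webc + e / (b + 1)) _)); first by rewrite ltrDl.
rewrite mulrDl lerD2l mulrAC ler_pdivrMr //; nra.
Qed.

Lemma ge_webc_lim a b : 0 <= a -> (forall k, 0 < k -> k < webc -> k * b <= a) ->
  webc * b <= a.
Proof.
move=> a0 H; have w0 := webc_gt0; have [b0|b0] := leP b 0.
  by apply: le_trans a0; rewrite pmulr_rle0.
apply/ler_addgt0Pr => e e0.
(* The maximum with [webc / 2] keeps [k] positive. *)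
pose k := Num.max (webc / 2) (webc - e / b).
have eb : 0 < e / b by rewrite divr_gt0.
have k0 : 0 < k by rewrite lt_max divr_gt0.
have kw : k < webc by rewrite gt_max; apply/andP; split; lra.
have := H k k0 kw; have : webc - e / b <= k by rewrite le_max lexx orbT.
move=> h1 h2; have : (webc - e / b) * b <= k * b by rewrite ler_pM2r.
by rewrite mulrBl divfK ?gt_eqF //; lra.
Qed.

Lemma pow43_surj a : 0 <= a -> exists2 b, 0 <= b & pow43 b = a.
Proof.
move=> a0; exists (Num.sqrt (Num.sqrt a) ^+ 3); first by rewrite exprn_ge0 ?sqrtr_ge0.
rewrite pow43E exprK_cbrt ?sqrtr_ge0 // -[4%N]/(2 * 2)%N exprM.
by rewrite !sqr_sqrtr // sqrtr_ge0.
Qed.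

End WebConstant.

(** * Bounds for the Dirichlet solution from above and below *)

Section Comparison.
Context {R : realType} {n : nat} (Omega : set 'rV[R]_n).
Context (Omega_nonempty : Omega !=set0) (Omega_open : open Omega).
Context (Omega_bounded : bounded_set Omega) (boundary0 : boundary Omega !=set0).
Context (u : 'rV[R]_n -> R) (u_solution : dirichlet_solution Omega u).
Implicit Types (x y z e v : 'rV[R]_n) (r k : R).

Local Notation d := (dist_boundary Omega).
Local Notation rho := (inradius Omega).

Let u_cont : {within closure Omega, continuous u}. Proof. by case: u_solution. Qed.
Let u_bd x : boundary Omega x -> u x = 0. Proof. by case: u_solution => _ + _; apply. Qed.
Let u_visc : viscosity_solution Omega u. Proof. by case: u_solution. Qed.

Let rho0 : 0 < rho. Proof. exact: inradius_gt0. Qed.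

Let closure0 : closure Omega !=set0.
Proof. by have [x Ox] := Omega_nonempty; exists x; exact: subset_closure. Qed.

Let compact_cl : compact (closure Omega).
Proof. exact: (compact_in_closure Omega_bounded (@closed_closure _ Omega)). Qed.

Lemma near_domain x : Omega x -> \forall y \near x, closure Omega y.
Proof.
move=> Ox; have : nbhs x Omega by exact: open_nbhs_nbhs.
by apply: filterS => y; exact: subset_closure.
Qed.

Let continuous_comp_dist (f : R -> R) z : continuous f ->
  continuous (fun x : 'rV[R]_n => f (enorm (x - z))).
Proof.
move=> cf x; apply: (@continuous_comp _ _ _ (fun x => enorm (x - z)) f).
  exact: continuous_enormB.
exact: cf.
Qed.

Let exists_unit : exists e : 'rV[R]_n, enorm e = 1.
Proof.
have [x Ox] := Omega_nonempty; have [p Bp] := boundary0.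
exists (dir x p); apply: enorm_dir; rewrite enorm_gt0 subr_eq0; apply/eqP => E.
by apply: (boundary_notin Omega_open Bp); rewrite -E.
Qed.

(** At an interior minimum the zero test function would give [1 <= 0], so the minimum lies on the
    boundary. *)
Lemma solution_ge0 x : closure Omega x -> 0 <= u x.
Proof.
have c0 : continuous (cst 0 : 'rV[R]_n -> R) by move=> y; exact: cst_continuous.
have [x0 cx0 H] := within_min closure0 compact_cl u_cont c0.
suff ux0 : 0 <= u x0 by move=> /H; rewrite !addr0; exact: le_trans.
have [Ox0|/u_bd ->//] := closure_cases Omega_open cx0.
have [e e1] := exists_unit.
have := @viscosity_min _ _ _ _ _ e 0 0 0 u_visc Ox0 e1.
rewrite mulr0 oppr0 ler10 => F; exfalso; suff : false by []; apply: F.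
apply: filterS (near_domain Ox0) => y /H; rewrite !addr0 /quad.
by rewrite !mul0r !addr0.
Qed.

(** A maximum of [u] minus the radial function over the part of the closed ball in the closure of
    [Omega] lies at [z], on the boundary of [Omega] (where [A >= 0] serves) or on the sphere;
    [no_contact_above] excludes all other points. *)
Lemma comparison_above z k rr A : webc < k -> 0 <= A ->
  (closure Omega z -> u z <= A) ->
  (forall x, Omega x -> enorm (x - z) = rr -> u x <= A + k * pow43 rr) ->
  forall x, closure Omega x -> enorm (x - z) <= rr ->
    u x <= A + k * (pow43 rr - pow43 (rr - enorm (x - z))).
Proof.
move=> kw A0 uz urr x cx xr.
have k0 : 0 < k by exact: lt_trans webc_gt0 kw.
pose H (t : R) := - (k * (pow43 rr - pow43 (rr - t))).
pose K := closure Omega `&` [set y | enorm (y - z) <= rr].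
have cK : compact K.
  apply: (compact_in_closure Omega_bounded); last by move=> y [].
  by apply: closedI; [exact: closed_closure|exact: closed_enorm_le].
have K0 : K !=set0 by exists x.
have cu : {within K, continuous u} by apply: continuous_subspaceW u_cont; move=> y [].
have cH : continuous H.
  move=> t; apply: cvgN; apply: cvgM; first exact: cvg_cst.
  apply: cvgB; first exact: cvg_cst.
  apply: (@cvg_comp _ _ _ (fun t : R => rr - t) pow43); last exact: continuous_pow43.
  by apply: cvgB; [exact: cvg_cst|exact: cvg_id].
have [x0 [cx0 /= x0r] Hx0] := within_max K0 cK cu (@continuous_comp_dist H z cH).
suff : u x0 + H (enorm (x0 - z)) <= A.
  by have := Hx0 x (conj cx xr); rewrite /H; lra.
have [zx0|zx0] := eqVneq x0 z.
  by rewrite /H zx0 subrr enorm0 subr0 subrr mulr0 oppr0 addr0 uz // -zx0.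
have r00 : 0 < enorm (x0 - z) by rewrite enorm_gt0 subr_eq0.
have [Ox0|/u_bd ->] := closure_cases Omega_open cx0; last first.
  have : pow43 (rr - enorm (x0 - z)) <= pow43 rr by rewrite le_pow43 // gerBl ltW.
  by rewrite add0r /H -subr_ge0 -(pmulr_rge0 _ k0); lra.
move: (x0r); rewrite le_eqVlt => /predU1P[E|lt0].
  by have := urr x0 Ox0 E; rewrite /H E subrr pow43_0; lra.
exfalso; apply: (no_contact_above u_visc Ox0 k0 (gt_webc kw) r00 lt0).
have N : \forall y \near x0, enorm (y - z) <= rr.
  apply/nbhs_enormP; exists (rr - enorm (x0 - z)); first by rewrite subr_gt0.
  move=> y yx; have := enormD (y - x0) (x0 - z); rewrite addrA subrK; lra.
apply: filterS2 (near_domain Ox0) N => y cy yr.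
by have := Hx0 y (conj cy yr); rewrite /H; lra.
Qed.

(** If the maximum, attained at [xs], were larger, comparison around the boundary point [y] nearest
    to [xs] would put [u] below a function of [|x - y|] with a concave kink at distance
    [L = |xs - y|]: slope [kap > 0] inside, constant outside. At such a kink a parabola with an
    intermediate slope and large negative curvature touches [u] from above. *)
Lemma solution_le_max x : closure Omega x -> u x <= webc * pow43 rho.
Proof.
have c0 : continuous (cst 0 : 'rV[R]_n -> R) by move=> y; exact: cst_continuous.
have [xs cxs Hxs] := within_max closure0 compact_cl u_cont c0.
move: Hxs => /= Hxs0; have Hxs y : closure Omega y -> u y <= u xs.
  by move=> /Hxs0; rewrite !addr0.
move=> cx; apply: (le_trans (Hxs _ cx)); rewrite leNgt; apply/negP => Mgt.
have prho : 0 < pow43 rho by exact: pow43_gt0.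
have M0 : 0 < u xs by apply: le_lt_trans Mgt; rewrite mulr_ge0 ?pow43_ge0 // ltW ?webc_gt0.
have Oxs : Omega xs.
  by have [//|/u_bd E] := closure_cases Omega_open cxs; move: M0; rewrite E ltxx.
have [y [By dE Hy]] := nearest_boundary Omega_bounded boundary0 xs.
pose L := enorm (xs - y).
have L0 : 0 < L by rewrite /L -dE dist_gt0.
have Lrho : L <= rho by rewrite /L -dE dist_le_inradius.
pose k := (webc + u xs / pow43 rho) / 2.
have Mw : webc < u xs / pow43 rho by rewrite ltr_pdivlMr.
have kw : webc < k by rewrite /k; lra.
have k0 : 0 < k by exact: lt_trans webc_gt0 kw.
have kM : k * pow43 rho < u xs.
  by rewrite -ltr_pdivlMr // /k; lra.
(* [rr] is the radius at which the radial function with constant [k] reaches the maximum of [u]; it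
   exceeds [rho] by the choice of [k]. *)
have [rr rr0 rrE] := @pow43_surj R (u xs / k) (divr_ge0 (ltW M0) (ltW k0)).
have kE : k * pow43 rr = u xs by rewrite rrE mulrC divfK // gt_eqF.
have rhor : rho < rr by apply: lt_pow43_inv; rewrite -(ltr_pM2l k0) kE.
have Lrr : L < rr by exact: le_lt_trans rhor.
(* Freezing the radial function beyond distance [L] is harmless: there [u <= u xs] already gives the
   bound. *)
pose H (t : R) := - (k * (pow43 rr - pow43 (rr - Num.min t L))).
have cH : continuous H.
  move=> t; apply: cvgN; apply: cvgM; first exact: cvg_cst.
  apply: cvgB; first exact: cvg_cst.
  apply: (@cvg_comp _ _ _ (fun t : R => rr - Num.min t L) pow43); last exact: continuous_pow43.
  apply: cvgB; first exact: cvg_cst.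
  exact: (@continuous_min R R id (cst L) t (@cvg_id _ (nbhs t)) (@cst_continuous _ _ _ _)).
have [x0 cx0 Hx0] := within_max closure0 compact_cl u_cont (@continuous_comp_dist H y cH).
have D0 : 0 < pow43 (rr - L) by rewrite pow43_gt0 // subr_gt0.
have HE t : H t = k * pow43 (rr - Num.min t L) - u xs.
  by rewrite /H mulrBr kE opprB.
have key x' : closure Omega x' -> u x' + H (enorm (x' - y)) <= k * pow43 (rr - L).
  move=> cx'; apply: (le_trans (Hx0 _ cx')); rewrite HE.
  have [Lx0|x0L] := leP L (enorm (x0 - y)).
    by have := Hxs _ cx0; lra.
  have [Ox0|/u_bd ->] := closure_cases Omega_open cx0; last first.
    have : k * pow43 (rr - enorm (x0 - y)) <= u xs.
      rewrite -kE ler_pM2l // le_pow43 // gerBl; exact: enorm_ge0.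
    have : 0 < k * pow43 (rr - L) by rewrite mulr_gt0.
    lra.
  exfalso.
  have r00 : 0 < enorm (x0 - y).
    rewrite enorm_gt0 subr_eq0; apply/eqP => E.
    by apply: (boundary_notin Omega_open By); rewrite -E.
  apply: (no_contact_above u_visc Ox0 k0 (gt_webc kw) r00 (lt_trans x0L Lrr)).
  apply: filterS (near_domain Ox0) => z /Hx0; rewrite !HE (min_idPl (ltW x0L)).
  have : pow43 (rr - enorm (z - y)) <= pow43 (rr - Num.min (enorm (z - y)) L).
    by apply: le_pow43; rewrite lerB // ge_min lexx.
  by rewrite -(ler_pM2l k0); lra.
(* The slope of the radial function at distance [L], positive because [L <= rho < rr]. *)
pose kap := 4 / 3 * k * cbrt (rr - L).
have kap0 : 0 < kap by rewrite /kap mulr_gt0 ?cbrt_gt0 ?subr_gt0 // mulr_gt0.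
have cone x' : closure Omega x' -> u x' <= u xs - kap * (L - Num.min (enorm (x' - y)) L).
  move=> /key; rewrite HE.
  set m := Num.min _ _ => h.
  have mL : m <= L by rewrite ge_min lexx orbT.
  have := @pow43_tangent R (rr - L) (rr - m).
  rewrite !subr_ge0 (ltW Lrr) (le_trans mL (ltW Lrr)) => /(_ isT isT).
  rewrite -(ler_pM2l k0) /kap; move: h; lra.
(* With slope [kap / 2] and second derivative [- 2 K], the parabola has [-Delta_infty = 2 > 1]. *)
pose K := (kap ^+ 2 / 4)^-1; have K0 : 0 < K by rewrite invr_gt0 divr_gt0 // exprn_gt0.
have := @viscosity_max _ _ _ u xs (dir xs y) (kap / 2) (- (2 * K)) (kap / L) u_visc Oxs
  (enorm_dir L0).
have -> : - ((kap / 2) ^+ 2 * - (2 * K)) = 2.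
  by rewrite /K; field; rewrite gt_eqF.
rewrite leNgt ltr1n /= => F; suff : false by []; apply: F.
have N := enorm_expand_near L0 (@ltr01 R).
have N' : \forall z \near xs, closure Omega z /\ K * enorm (z - xs) <= kap / 2.
  apply: filterS2 (near_domain Oxs)
    (_ : \forall z \near xs, K * enorm (z - xs) <= kap / 2) => [z cz ?//|].
  apply/nbhs_enormP; exists (kap / 2 / K); first by rewrite !divr_gt0.
  by move=> z; rewrite ltr_pdivlMr // mulrC => /ltW.
apply: filterS2 N N' => z [s [b [t [sE bE tE zy [_ b0 b1 _]]]]] [cz zk].
apply: (le_trans (cone _ cz)); rewrite /quad -sE -bE lerD2l.
have bL : 0 <= b / L by rewrite divr_ge0 // ltW.
have sK : K * `|s| <= kap / 2.
  apply: le_trans zk; rewrite ler_pM2l // sE.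
  exact: dot_unit_bound (enorm_dir L0).
have mL : Num.min (enorm (z - y)) L <= L by rewrite ge_min lexx orbT.
have mr : Num.min (enorm (z - y)) L <= L + t.
  by apply: le_trans zy; rewrite ge_min lexx.
move: mL mr; set m := Num.min _ _ => mL mr.
rewrite -[_ / L * b]mulrAC -mulrA.
(* Outside, the parabola is compared with slope [0]; inside, with slope [kap]. Its initial slope
   [kap / 2] leaves room for [- K s^2] on both sides. *)
have [s0|s0] := leP 0 s.
  have h1 : 0 <= kap * (L - m) by rewrite mulr_ge0 ?subr_ge0 // ltW.
  have h2 : 0 <= kap * (b / L) by rewrite mulr_ge0 // ltW.
  rewrite ger0_norm // in sK.
  have h3 : 0 <= s * (kap / 2 - K * s) by rewrite mulr_ge0 // subr_ge0.
  move: h1 h2 h3; lra.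
rewrite ltr0_norm // in sK.
have h1 : 0 <= kap * (L + t - m) by rewrite mulr_ge0 ?subr_ge0 // ltW.
have h3 : 0 <= - s * (kap / 2 - K * - s) by rewrite mulr_ge0 ?subr_ge0 // oppr_ge0 ltW.
move: h1 h3; rewrite tE; lra.
Qed.

Lemma solution_le_boundary x y : closure Omega x -> boundary Omega y ->
  u x <= webc * (pow43 rho - pow43 (rho - enorm (x - y))).
Proof.
move=> cx By.
apply: le_webc_lim => [|k kw].
  by rewrite subr_ge0 le_pow43 // gerBl enorm_ge0.
have k0 : 0 < k by exact: lt_trans webc_gt0 kw.
have max_le z : closure Omega z -> u z <= k * pow43 rho.
  move=> /solution_le_max /le_trans; apply.
  by rewrite ler_wpM2r ?pow43_ge0 // ltW.
(* Beyond distance [rho] the truncated [pow43] vanishes and the claim is the bound on the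
   maximum. *)
have [xr|xr] := leP (enorm (x - y)) rho; last first.
  rewrite [pow43 (_ - _)]pow43E cbrt_le0 ?subr_le0 ?(ltW xr) //.
  by rewrite expr0n subr0 max_le.
rewrite -[leRHS]add0r; apply: comparison_above => //.
  by move=> _; rewrite u_bd.
by move=> z Oz _; rewrite add0r max_le //; exact: subset_closure.
Qed.

Lemma solution_le_web x : closure Omega x ->
  u x <= webc * (pow43 rho - pow43 (rho - d x)).
Proof.
move=> cx; have [y [By -> _]] := nearest_boundary Omega_bounded boundary0 x.
exact: solution_le_boundary.
Qed.

(** If [u < k pow43 rr] on the whole sphere, then [comparison_above] around [x0] with [A = u x0]
    bounds the gradient at [x0] by the slope [4/3 k cbrt rr] of the radial function at its
    centre. *)
Lemma slope_propagation x0 k rr : Omega x0 -> differentiable u x0 ->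
  webc < k -> 0 < rr -> 4 / 3 * k * cbrt rr < enorm (grad u x0) ->
  exists y, [/\ Omega y, enorm (y - x0) = rr & k * pow43 rr <= u y].
Proof.
move=> Ox0 du kw rr0 sl; have k0 : 0 < k by exact: lt_trans webc_gt0 kw.
apply: contrapT => NE.
have ux0 : 0 <= u x0 by apply: solution_ge0; exact: subset_closure.
have C := @comparison_above x0 k rr (u x0) kw ux0 (fun _ => lexx _).
have {}C : forall x, closure Omega x -> enorm (x - x0) <= rr ->
    u x <= u x0 + k * (pow43 rr - pow43 (rr - enorm (x - x0))).
  apply: C => x Ox xr; rewrite leNgt; apply/negP => h.
  by apply: NE; exists x; split => //; lra.
pose sg := 4 / 3 * k * cbrt rr.
have Cs x : closure Omega x -> enorm (x - x0) <= rr -> u x <= u x0 + sg * enorm (x - x0).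
  move=> cx xr; apply: (le_trans (C x cx xr)); rewrite lerD2l /sg.
  have := @pow43_tangent R rr (rr - enorm (x - x0)).
  rewrite subr_ge0 (ltW rr0) xr => /(_ isT isT).
  rewrite -(ler_pM2l k0); lra.
pose v := grad u x0.
have v0 : 0 < enorm v.
  by apply: le_lt_trans sl; rewrite !mulr_ge0 ?cbrt_ge0 // ltW.
have [r r0 rO] := open_enorm Omega_open Ox0.
have : 'D_v u x0 <= sg * enorm v.
  apply: (@derive_le _ _ u x0 v _ (Num.min r rr / enorm v)) => //.
    by rewrite divr_gt0 // lt_min r0.
  move=> h h0; rewrite ltr_pdivlMr // lt_min => /andP[hr hrr].
  have E : x0 + h *: v - x0 = h *: v by rewrite addrAC subrr add0r.
  have Eh : enorm (x0 + h *: v - x0) = h * enorm v by rewrite E enormZ gtr0_norm.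
  have := Cs (x0 + h *: v); rewrite Eh ltW // => C'.
  have Oh : closure Omega (x0 + h *: v).
    by apply: subset_closure; apply: rO; rewrite Eh.
  move: (C' Oh isT); lra.
rewrite derive_grad // -/v -sqr_enorm expr2 ler_pM2r // leNgt => /negP; apply.
exact: sl.
Qed.

(** The minimum of [u + k |x - z|^(4/3)] is attained at [z], giving the first alternative, or on the
    boundary, giving the second; [no_contact_below] excludes other points. *)
Lemma cap_min z k : Omega z -> 0 < k -> k < webc -> forall x, closure Omega x ->
  Num.min (u z) (k * pow43 (d z)) <= u x + k * pow43 (enorm (x - z)).
Proof.
move=> Oz k0 kw x cx.
have cH : continuous (fun t : R => k * pow43 t).
  by move=> t; apply: cvgM; [exact: cvg_cst|exact: continuous_pow43].
have [x1 cx1 Hx1] := within_min closure0 compact_cl u_cont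
  (@continuous_comp_dist _ z cH).
apply: le_trans (Hx1 x cx); rewrite ge_min.
have [<-|x1z] := eqVneq x1 z.
  by rewrite lerDl mulr_ge0 ?pow43_ge0 // ltW.
have [Ox1|Bx1] := closure_cases Omega_open cx1; last first.
  rewrite (u_bd Bx1) add0r ler_pM2l // [X in _ || X]le_pow43 ?orbT //.
  by rewrite enormB dist_le.
exfalso; apply: (@no_contact_below _ _ _ _ _ z k u_visc Ox1 k0 (lt_webc k0 kw)).
  by rewrite enorm_gt0 subr_eq0.
apply: filterS (near_domain Ox1) => y /Hx1; lra.
Qed.

Lemma continuous_solution x : Omega x -> {for x, continuous u}.
Proof.
move=> Ox; have cu : {within Omega, continuous u}.
  by apply: continuous_subspaceW u_cont; exact: subset_closure.
rewrite continuous_open_subspace // in cu.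
by apply: cu; rewrite inE.
Qed.

(** Otherwise, by continuity, [cap_min] gives [u x <= u y + k |y - x|^(4/3)] for all [x] near [z].
    An exponent above one forbids any slope, so [u + K |x - z|^2] can have its minimum only at [z],
    and there a test function with zero gradient gives [1 <= 0]. *)
Lemma solution_ge_center z k : Omega z -> 0 < k -> k < webc -> k * pow43 (d z) <= u z.
Proof.
move=> Oz k0 kw; rewrite leNgt; apply/negP => uz.
have [del del0 Hdel] : exists2 del, 0 < del &
    forall x, enorm (x - z) < del -> Omega x /\ u x < k * pow43 (d x).
  pose gap := k * pow43 (d z) - u z; have gap0 : 0 < gap by rewrite subr_gt0.
  have cd : {for z, continuous (fun x => k * pow43 (d x))}.
    apply: (@continuous_comp _ _ _ d (fun t => k * pow43 t)).
      exact: (continuous_dist Omega_bounded boundary0).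
    by apply: cvgM; [exact: cvg_cst|exact: continuous_pow43].
  have g4 : 0 < gap / 4 by rewrite divr_gt0.
  have [r1 r10 H1] := (continuous_enormP _ _).1 cd _ g4.
  have [r2 r20 H2] := (continuous_enormP _ _).1 (continuous_solution Oz) _ g4.
  have [r3 r30 H3] := open_enorm Omega_open Oz.
  exists (Num.min r1 (Num.min r2 r3)); first by rewrite !lt_min r10 r20.
  move=> x; rewrite !lt_min => /and3P[/H1 x1 /H2 x2 /H3 x3]; split => //.
  move: x1 x2; rewrite !ler_norml => /andP[x1 _] /andP[_ x2].
  move: g4 x1 x2; rewrite /gap; lra.
have peak x y : enorm (x - z) < del -> closure Omega y ->
    u x <= u y + k * pow43 (enorm (y - x)).
  move=> /Hdel[Ox ux] cy; have := cap_min Ox k0 kw cy.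
  by rewrite (min_idPl (ltW ux)).
have uz0 : 0 <= u z by apply: solution_ge0; exact: subset_closure.
(* So large that [K D^2 <= u z] puts the minimum point within [del] of [z]. *)
pose K := (u z + 1) / del ^+ 2.
have K0 : 0 < K by rewrite divr_gt0 ?exprn_gt0 //; lra.
have cH : continuous (fun t : R => K * t ^+ 2).
  by move=> t; apply: cvgM; [exact: cvg_cst|exact: exprn_continuous].
have [x1 cx1 Hx1] := within_min closure0 compact_cl u_cont
  (@continuous_comp_dist _ z cH).
pose D := enorm (x1 - z); have D0 : 0 <= D by exact: enorm_ge0.
have KD : K * D ^+ 2 <= u z.
  have := Hx1 z (subset_closure Oz); have := solution_ge0 cx1.
  rewrite /= subrr enorm0 -/D; lra.
have Ddel : D < del.
  rewrite -(@ltr_pXn2r _ 2) ?nnegrE ?(ltW del0) // -(ltr_pM2l K0).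
  apply: (le_lt_trans KD); rewrite /K divfK ?ltrDl //.
  by rewrite gt_eqF // exprn_gt0.
have [Ox1 _] := Hdel _ Ddel.
have [Dz|Dgt] := leP D 0.
  have x1z : x1 = z by apply/eqP; rewrite -subr_eq0 -[_ == 0]negbK -enorm_gt0 -leNgt.
  have [e e1] := exists_unit.
  have := @viscosity_min _ _ _ _ _ e 0 (- (2 * K)) (- K) u_visc Ox1 e1.
  rewrite expr0n mul0r oppr0 ler10 => F; suff : false by []; apply: F.
  apply: filterS (near_domain Ox1) => y /Hx1.
  have D00 : D = 0 by apply/eqP; rewrite eq_le Dz D0.
  rewrite -/D D00 x1z sqr_enorm /quad; lra.
(* A step of length [w^3] from [x1] towards [z] lowers the parabola by at least [K D w^3], while [u]
   rises by at most [k w^4]; [w] is chosen with [k w < K D]. *)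
pose w := Num.min (cbrt D) (K * D / (2 * k)).
have w0 : 0 < w by rewrite lt_min cbrt_gt0 // divr_gt0 // mulr_gt0.
have wD : w ^+ 3 <= D.
  rewrite -[leRHS](cbrtK D0) ler_pXn2r ?nnegrE ?cbrt_ge0 ?(ltW w0) //.
  by rewrite ge_min lexx.
have wK : k * w < K * D.
  have : w <= K * D / (2 * k) by rewrite ge_min lexx orbT.
  rewrite ler_pdivlMr ?mulr_gt0 //; have := mulr_gt0 k0 w0; lra.
pose x := x1 - w ^+ 3 *: dir x1 z.
have w3 : 0 < w ^+ 3 by rewrite exprn_gt0.
have xz : x - z = (D - w ^+ 3) *: dir x1 z.
  by rewrite scalerBl dirK // /x addrAC.
have exz : enorm (x - z) = D - w ^+ 3.
  by rewrite xz enormZ enorm_dir // mulr1 ger0_norm // subr_ge0.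
have xdel : enorm (x - z) < del by rewrite exz; lra.
have [Ox _] := Hdel _ xdel.
have := peak x x1 xdel cx1; have := Hx1 x (subset_closure Ox).
rewrite exz -/D /x opprB addrCA subrr addr0 enormZ enorm_dir // mulr1 gtr0_norm //.
rewrite pow43E exprK_cbrt ?(ltW w0) // -/x => h1 h2.
have : K * D * w ^+ 3 <= k * w * w ^+ 3.
  have : 0 <= K * w ^+ 3 * (D - w ^+ 3) by rewrite mulr_ge0 ?subr_ge0 // mulr_ge0 // ltW.
  move: h1 h2; rewrite -[4%N]/(1 + 3)%N exprD expr1; lra.
by rewrite ler_pM2r // leNgt wK.
Qed.

Lemma solution_ge_cap z x : Omega z -> closure Omega x ->
  webc * (pow43 (d z) - pow43 (enorm (x - z))) <= u x.
Proof.
move=> Oz cx; apply: ge_webc_lim; first exact: solution_ge0.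
move=> k k0 kw; have := cap_min Oz k0 kw cx.
rewrite (min_idPr _) ?solution_ge_center //; lra.
Qed.

End Comparison.

(** * The overdetermined problem *)

Lemma convex_midpoint (R : realType) (n : nat) (A : set 'rV[R]_n) x v :
  convex_set A -> A (x + v) -> A (x - v) -> A x.
Proof.
move=> cA Ap Am.
have h0 : 0 <= 2^-1 :> R by rewrite invr_ge0.
have h1 : 2^-1 <= 1 :> R by rewrite invf_le1 // ler1n.
have E : 2^-1 *: (x + v) + (1 - 2^-1) *: (x - v) = x.
  have -> : 1 - 2^-1 = 2^-1 :> R by field.
  rewrite -scalerDr addrACA subrr addr0.
  by rewrite scalerDr -scalerDl -[2^-1]mul1r -splitr scale1r.
rewrite -{}E; apply: set_mem.
exact: (cA (x + v) (x - v) (Itv01 h0 h1) (mem_set Ap) (mem_set Am)).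
Qed.

Section Neumann.
Context {R : realType} {n : nat} (Omega : set 'rV[R]_n) (a : R).
Context (Omega_nonempty : Omega !=set0) (Omega_open : open Omega).
Context (Omega_bounded : bounded_set Omega) (boundary0 : boundary Omega !=set0).
Context (u : 'rV[R]_n -> R) (u_solution : dirichlet_solution Omega u).
Context (delta : R) (delta_gt0 : 0 < delta) (gradu : 'rV[R]_n -> 'rV[R]_n).
Context (u_C1 : C1_up_to_boundary Omega delta u gradu).
Context (u_neumann : forall x, boundary Omega x -> enorm (gradu x) = a).
Implicit Types (x y z e v : 'rV[R]_n) (r k : R).

Local Notation d := (dist_boundary Omega).
Local Notation rho := (inradius Omega).

Let rho0 : 0 < rho. Proof. exact: inradius_gt0. Qed.
Let subcl x : Omega x -> closure Omega x. Proof. exact: subset_closure. Qed.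
Let u_le_max := solution_le_max Omega_nonempty Omega_open Omega_bounded boundary0 u_solution.
Let ge_cap := solution_ge_cap Omega_nonempty Omega_open Omega_bounded boundary0 u_solution.
Let le_bd := solution_le_boundary Omega_nonempty Omega_open Omega_bounded boundary0 u_solution.
Let slope := slope_propagation Omega_nonempty Omega_open Omega_bounded boundary0 u_solution.

Lemma grad_near_boundary y eps : boundary Omega y -> 0 < eps ->
  exists2 r, 0 < r & forall x, Omega x -> enorm (x - y) < r ->
    differentiable u x /\ `|enorm (grad u x) - a| <= eps.
Proof.
move=> By eps0; have [uG] := u_C1.
have Cy : collar Omega delta y.
  by split; [exact: boundary_closure By|rewrite dist_boundary0].
move=> /subspace_continuousP/(_ y Cy) cG.
have : nbhs (gradu y) [set v | `|enorm v - a| <= eps].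
  have [r r0 H] := (continuous_enormP _ _).1 (@continuous_enorm R n (gradu y)) eps eps0.
  by apply/nbhs_enormP; exists r => // v /H; rewrite u_neumann.
move=> /cG /nbhs_enormP [r r0 H].
exists (Num.min r delta); first by rewrite lt_min r0.
move=> x Ox; rewrite lt_min => /andP[/H xr xd].
have dx : d x < delta by apply: le_lt_trans xd; exact: dist_le.
have [du <-] := uG x Ox dx; split => //.
by apply: xr; split => //; exact: subcl.
Qed.

(** The right side is the boundary slope of the web function. A larger [a] would propagate from near
    the boundary to distance [rho] with some [k > webc], against the bound on the maximum. *)
Lemma neumann_le : a <= 4 / 3 * webc * cbrt rho.
Proof.
have [y By] := boundary0.
rewrite leNgt; apply/negP => alt.
have c0 : 0 < cbrt rho by exact: cbrt_gt0.
pose k := (webc + a / (4 / 3 * cbrt rho)) / 2.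
have ak : webc < a / (4 / 3 * cbrt rho).
  by rewrite ltr_pdivlMr ?mulr_gt0 //; lra.
have kw : webc < k by rewrite /k; lra.
have ka : 4 / 3 * k * cbrt rho < a.
  have : k < a / (4 / 3 * cbrt rho) by rewrite /k; lra.
  by rewrite ltr_pdivlMr ?mulr_gt0 //; lra.
have e0 : 0 < (a - 4 / 3 * k * cbrt rho) / 2 by rewrite divr_gt0 // subr_gt0.
have [r r0 H] := grad_near_boundary By e0.
have [x Ox xy] := (closure_enorm _ _).1 (boundary_closure By) r r0.
have [du] := H x Ox xy; rewrite ler_norml => /andP[g _].
have sl : 4 / 3 * k * cbrt rho < enorm (grad u x) by lra.
have [z [Oz _ uz]] := slope Ox du kw rho0 sl.
have := u_le_max (subcl Oz); rewrite leNgt => /negP; apply.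
by apply: lt_le_trans uz; rewrite ltr_pM2r // pow43_gt0.
Qed.

(** On the segment from [c] to [p] the upper bound from [p] and the cap at [c] coincide, so [u] is
    explicit there and its slope tends to the left side at [p]. *)
Lemma neumann_ge c p : Omega c -> d c = rho -> boundary Omega p ->
  enorm (p - c) = rho -> 4 / 3 * webc * cbrt rho <= a.
Proof.
move=> Oc dc Bp pc; rewrite leNgt; apply/negP => alt.
have w0 := @webc_gt0 R.
pose e := dir p c.
have e1 : enorm e = 1 by apply: enorm_dir; rewrite pc.
have pE : p = c + rho *: e by rewrite -pc dirK ?pc // addrC subrK.
have a0 : 0 <= a by rewrite -(u_neumann Bp) enorm_ge0.
pose sg := (a + 4 / 3 * webc * cbrt rho) / 2.
have sga : a < sg by rewrite /sg; lra.
have sg0 : 0 < sg by exact: le_lt_trans sga.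
(* At distance [w^3] from [c] the explicit profile has slope [sg]; beyond it the slope is larger. *)
pose w := sg / (4 / 3 * webc); have w1 : 0 < w by rewrite divr_gt0 // mulr_gt0.
have wE : 4 / 3 * webc * w = sg by rewrite mulrC divfK // gt_eqF // mulr_gt0.
have wrho : w ^+ 3 < rho.
  rewrite -(cbrtK (ltW rho0)) ltr_pXn2r ?nnegrE ?cbrt_ge0 ?(ltW w1) //.
  by rewrite /w ltr_pdivrMr ?mulr_gt0 // /sg; lra.
have eps0 : 0 < (sg - a) / 2 by rewrite divr_gt0 // subr_gt0.
have [r r0 H] := grad_near_boundary Bp eps0.
(* A point of the segment past distance [w^3] and within [r] of [p]. *)
pose t := Num.max ((w ^+ 3 + rho) / 2) (rho - r / 2).
have t1 : w ^+ 3 < t by rewrite lt_max; apply/orP; left; lra.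
have t2 : t < rho by rewrite gt_max; apply/andP; split; lra.
have t3 : rho - r / 2 <= t by rewrite le_max lexx orbT.
have t0 : 0 < t by apply: lt_trans t1; rewrite exprn_gt0.
have Oray s : 0 <= s -> s < rho -> Omega (c + s *: e).
  move=> s0 sr; apply: (ball_dist_subset Omega_open Omega_bounded boundary0 Oc).
  by rewrite addrAC subrr add0r enormZ e1 mulr1 ger0_norm // dc.
have uray s : 0 <= s -> s < rho -> u (c + s *: e) = webc * (pow43 rho - pow43 s).
  move=> s0 sr; have cO := subcl (Oray s s0 sr).
  apply/eqP; rewrite eq_le; apply/andP; split.
    apply: (le_trans (le_bd cO Bp)).
    have -> : c + s *: e - p = (s - rho) *: e.
      by rewrite pE opprD addrACA subrr add0r scalerBl.
    by rewrite enormZ e1 mulr1 ler0_norm ?subr_le0 ?(ltW sr) // opprB opprD opprK addrA subrr add0r.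
  apply: le_trans (ge_cap Oc cO).
  by rewrite addrAC subrr add0r enormZ e1 mulr1 ger0_norm // dc.
have Oxt := Oray t (ltW t0) t2.
have xtp : enorm (c + t *: e - p) < r.
  have -> : c + t *: e - p = (t - rho) *: e.
    by rewrite pE opprD addrACA subrr add0r scalerBl.
  rewrite enormZ e1 mulr1 ler0_norm ?subr_le0 ?(ltW t2) //; lra.
have [du] := H _ Oxt xtp; rewrite ler_norml => /andP[_ g].
have : sg <= 'D_(- e) u (c + t *: e).
  have tw0 : 0 < t - w ^+ 3 by rewrite subr_gt0.
  apply: (derive_ge tw0 du) => h h0 ht.
  have th : w ^+ 3 < t - h by lra.
  have th0 : 0 < t - h by apply: lt_trans th; rewrite exprn_gt0.
  have -> : c + t *: e + h *: - e = c + (t - h) *: e.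
    by rewrite scalerBl scalerN addrA.
  rewrite !uray ?(ltW th0) ?(ltW t0) //; last by lra.
  have T := @pow43_tangent R (t - h) t (ltW th0) (ltW t0).
  have C : w <= cbrt (t - h) by rewrite -(exprK_cbrt (ltW w1)) le_cbrt // ltW.
  rewrite -wE; have : 4 / 3 * webc * h * w <= 4 / 3 * webc * h * cbrt (t - h).
    by rewrite ler_pM2l // !mulr_gt0.
  have := ler_wpM2l (ltW w0) T; lra.
rewrite derive_grad // => D; have := dot_le (- e) (grad u (c + t *: e)).
rewrite enormN e1 mul1r; move: D g sga; lra.
Qed.

(** * Ridge points, normal rays and the cut locus *)

Context (neumannE : a = 4 / 3 * webc * cbrt rho).

(** Take [z] maximal for [u] in the closed [rho]-ball around [y]. Slope propagation from points near
    [y] makes [u z] as large as the global bound, and [solution_le_boundary] then keeps [z] at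
    distance at least [rho] from every boundary point. *)
Lemma ridge_above y : boundary Omega y ->
  exists z, [/\ Omega z, d z = rho & enorm (z - y) = rho].
Proof.
move=> By; have w0 := @webc_gt0 R.
pose K := closure Omega `&` [set x | enorm (x - y) <= rho].
have cK : compact K.
  apply: (compact_in_closure Omega_bounded); last by move=> x [].
  by apply: closedI; [exact: closed_closure|exact: closed_enorm_le].
have K0 : K !=set0.
  by exists y; split; [exact: boundary_closure By|rewrite /= subrr enorm0 ltW].
have cu : {within K, continuous u}.
  by have [+ _ _] := u_solution; apply: continuous_subspaceW => x [].
have c0 : continuous (cst 0 : 'rV[R]_n -> R) by move=> x; exact: cst_continuous.
have [z [cz /= zy] Hz0] := within_max K0 cK cu c0.
have Hz x : K x -> u x <= u z by move=> /Hz0; rewrite !addr0.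
have uz0 : 0 <= u z by exact: (solution_ge0 Omega_nonempty _ _ _ u_solution).
have uz : webc * pow43 rho <= u z.
  rewrite leNgt; apply/negP => lt.
  have lt' : u z / webc < pow43 rho by rewrite ltr_pdivrMr // mulrC.
  have uw0 : 0 <= u z / webc by rewrite divr_ge0 // ltW.
  have m0 : 0 < (u z / webc + pow43 rho) / 2 by lra.
  (* A radius [b < rho] still with [u z < webc * pow43 b]. The gap [rho - b] keeps the propagated
     point in the ball around [y], and [cbrt b < cbrt rho] leaves room for some [k > webc] of slope
     below [a]. *)
  have [b b0 bE] := pow43_surj (ltW m0).
  have brho : b < rho by apply: lt_pow43_inv; rewrite bE; lra.
  have b1 : 0 < b.
    by rewrite lt_neqAle b0 andbT; apply/eqP => E; move: m0; rewrite -bE -E pow43_0 ltxx.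
  have ub : u z < webc * pow43 b.
    by rewrite mulrC -ltr_pdivrMr // bE; lra.
  have cb0 := cbrt_gt0 b1.
  have cb1 : cbrt b < cbrt rho by exact: lt_cbrt.
  pose k := (webc + a / (4 / 3 * cbrt b)) / 2.
  have ak : webc < a / (4 / 3 * cbrt b).
    rewrite ltr_pdivlMr ?mulr_gt0 // neumannE.
    have : webc * cbrt b < webc * cbrt rho by rewrite ltr_pM2l.
    lra.
  have kw : webc < k by rewrite /k; lra.
  have ka : 4 / 3 * k * cbrt b < a.
    have : k < a / (4 / 3 * cbrt b) by rewrite /k; lra.
    by rewrite ltr_pdivlMr ?mulr_gt0 //; lra.
  have e0 : 0 < (a - 4 / 3 * k * cbrt b) / 2 by rewrite divr_gt0 // subr_gt0.
  have [r r0 H] := grad_near_boundary By e0.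
  have rb0 : 0 < Num.min r (rho - b) by rewrite lt_min r0 subr_gt0.
  have [x Ox] := (closure_enorm _ _).1 (boundary_closure By) _ rb0.
  rewrite lt_min => /andP[xy xb].
  have [du] := H x Ox xy; rewrite ler_norml => /andP[g _].
  have sl : 4 / 3 * k * cbrt b < enorm (grad u x) by lra.
  have [z' [Oz' z'x uz']] := slope Ox du kw b1 sl.
  have : K z'.
    split; first exact: subcl.
    rewrite /=; have := enormD (z' - x) (x - y); rewrite addrA subrK; lra.
  move=> /Hz; rewrite leNgt => /negP; apply.
  apply: lt_le_trans ub _; apply: le_trans uz'.
  by rewrite ler_wpM2r ?pow43_ge0 // ltW.
have far y' : boundary Omega y' -> rho <= enorm (z - y').
  move=> By'; have := le_trans uz (le_bd cz By'); rewrite ler_pM2l // => h.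
  rewrite -subr_le0 leNgt; apply/negP => /pow43_gt0; lra.
have Oz : Omega z.
  have [//|Bz] := closure_cases Omega_open cz.
  by have := far z Bz; rewrite subrr enorm0 leNgt rho0.
exists z; split => //; apply/eqP; rewrite eq_le.
  by rewrite dist_le_inradius //=; exact: dist_ge.
by rewrite zy far.
Qed.

Context (Omega_convex : convex_set Omega).

(* Two balls inside the convex set [Omega] that touch its boundary at the same
   point [y] have the same normal there: otherwise [y] would be the midpoint
   of a point of the one and a point of the other. *)
Lemma same_normal x z y : boundary Omega y -> Omega x -> Omega z ->
  d x = enorm (x - y) -> d z = enorm (z - y) -> dir x y = dir z y.
Proof.
move=> By Ox Oz dx dz.
have x0 : 0 < enorm (x - y) by rewrite -dx dist_gt0.
have z0 : 0 < enorm (z - y) by rewrite -dz dist_gt0.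
have [//|ne] := eqVneq (dir x y) (dir z y); exfalso.
have e1 := enorm_dir x0; have e2 := enorm_dir z0.
pose w := dir x y - dir z y; pose D := 1 - dot (dir x y) (dir z y).
have ww : dot w w = 2 * D.
  rewrite /w /D; move: (dir x y) (dir z y) e1 e2 => e e' e1 e2.
  rewrite !dotE -!sqr_enorm e1 e2 (dotC e' e); ring.
have D0 : 0 < D.
  have : 0 < enorm w by rewrite enorm_gt0 subr_eq0.
  by move=> /(exprn_gt0 2); rewrite sqr_enorm ww; lra.
have w1 : dot w (dir x y) = D.
  rewrite /w /D; move: (dir x y) (dir z y) e1 => e e' e1.
  by rewrite !dotE -sqr_enorm e1 (dotC e'); ring.
have w2 : dot w (dir z y) = - D.
  rewrite /w /D; move: (dir x y) (dir z y) e2 => e e' e2.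
  by rewrite !dotE -sqr_enorm e2; ring.
move: w D ww D0 w1 w2 => w D ww D0 w1 w2.
(* For a ball of radius [r] whose centre lies from [y] along the unit vector [e = dir x y],
   [|t w - r e|^2 = r^2 - 2 t D (r - t)], and likewise for [- t w] and [dir z y]; any positive [t]
   below both radii works. *)
pose t := Num.min (enorm (x - y)) (enorm (z - y)) / 2.
have m0 : 0 < Num.min (enorm (x - y)) (enorm (z - y)) by rewrite lt_min x0.
have t0 : 0 < t by rewrite divr_gt0.
have : t < Num.min (enorm (x - y)) (enorm (z - y)).
  by rewrite /t ltr_pdivrMr // mulr_natr mulr2n ltrDl.
rewrite lt_min => /andP[tx tz].
apply: (boundary_notin Omega_open By).
apply: (@convex_midpoint _ _ _ y (t *: w) Omega_convex).
  apply: (ball_dist_subset Omega_open Omega_bounded boundary0 Ox).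
  rewrite dx -(@ltr_pXn2r _ 2) ?nnegrE ?enorm_ge0 //.
  have -> : y + t *: w - x = t *: w - enorm (x - y) *: dir x y.
    by rewrite dirK // opprB [LHS]addrAC [LHS]addrC.
  rewrite sqr_enorm; move: (enorm (x - y)) x0 tx (dir x y) e1 w1 => r r0 tr e e1 w1.
  rewrite !dotE -[dot e e]sqr_enorm e1 ww (dotC e w) w1.
  have := mulr_gt0 (mulr_gt0 t0 D0) (_ : 0 < r - t); rewrite subr_gt0 => /(_ tr); lra.
apply: (ball_dist_subset Omega_open Omega_bounded boundary0 Oz).
rewrite dz -(@ltr_pXn2r _ 2) ?nnegrE ?enorm_ge0 //.
have -> : y - t *: w - z = - (t *: w + enorm (z - y) *: dir z y).
  by rewrite dirK // opprD opprB [LHS]addrAC [LHS]addrC.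
rewrite enormN sqr_enorm; move: (enorm (z - y)) z0 tz (dir z y) e2 w2 => r r0 tr e e2 w2.
rewrite !dotE -[dot e e]sqr_enorm e2 ww (dotC e w) w2.
have := mulr_gt0 (mulr_gt0 t0 D0) (_ : 0 < r - t); rewrite subr_gt0 => /(_ tr); lra.
Qed.

(** The ridge point over the nearest boundary point [y] shares its normal with [x]. Hence
    [|x - z| = rho - d x], which makes the cap at [z] meet the web bound at [x]. *)
Lemma on_ray x : Omega x -> exists y z, [/\ boundary Omega y, Omega z, d z = rho,
  d x = enorm (x - y) & x - z = (d x - rho) *: dir x y].
Proof.
move=> Ox; have [y [By dx _]] := nearest_boundary Omega_bounded boundary0 x.
have [z [Oz dz zy]] := ridge_above By.
exists y, z; split => //.
have z0 : 0 < enorm (z - y) by rewrite zy.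
have x0 : 0 < enorm (x - y) by rewrite -dx dist_gt0.
have zyE := dirK z0; have xyE := dirK x0.
have N := same_normal By Ox Oz dx (etrans dz (esym zy)).
by rewrite scalerBl dx xyE N -zy zyE opprB addrA subrK.
Qed.

Lemma solution_eq_web x : closure Omega x -> u x = webc * (pow43 rho - pow43 (rho - d x)).
Proof.
move=> cx; have [Ox|Bx] := closure_cases Omega_open cx; last first.
  rewrite dist_boundary0 // subr0 subrr mulr0.
  by have [_ + _] := u_solution; apply.
apply/eqP; rewrite eq_le solution_le_web //=.
have [y [z [By Oz dz dx xz]]] := on_ray Ox.
apply: le_trans (ge_cap Oz cx); rewrite dz xz enormZ enorm_dir -?dx ?dist_gt0 // mulr1.
by rewrite ler0_norm ?opprB // subr_le0 dist_le_inradius.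
Qed.

(** [rho - |x - z|] and [|x - y|] enclose [d] and agree with it at [x], with the same gradient
    [dir x y] and quadratic errors; [d x < rho] keeps [x] away from [z]. *)
Lemma dist_differentiable x : Omega x -> d x < rho -> differentiable d x.
Proof.
move=> Ox xr; have [y [z [By Oz dz dx xz]]] := on_ray Ox.
have x0 : 0 < enorm (x - y) by rewrite -dx dist_gt0.
have exz : enorm (x - z) = rho - d x.
  by rewrite xz enormZ enorm_dir // mulr1 ler0_norm ?opprB // subr_le0 ltW.
have z0 : 0 < enorm (x - z) by rewrite exz subr_gt0.
have dirE : dir x z = - dir x y.
  rewrite /dir exz xz -/(dir x y) scalerA -(opprB rho (d x)) mulrN mulVf ?scaleN1r //.
  by rewrite subr_eq0 gt_eqF.
pose C := (enorm (x - y))^-1 + (enorm (x - z))^-1.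
pose r := Num.min (enorm (x - y)) (enorm (x - z)) / 2.
have r0 : 0 < r by rewrite divr_gt0 // lt_min x0.
suff H v : enorm v < r -> `|d (x + v) - d x - dot v (dir x y)| <= C * enorm v ^+ 2.
  by have [] := diff_sqr r0 H.
move=> vr.
have vm : enorm v < Num.min (enorm (x - y)) (enorm (x - z)) / 2 by [].
have xv : x + v - x = v by rewrite addrAC subrr add0r.
have v1 : enorm (x + v - x) <= enorm (x - y) / 2.
  rewrite xv; apply: (le_trans (ltW vm)).
  by rewrite ler_pM2r // ge_min lexx.
have v2 : enorm (x + v - x) <= enorm (x - z) / 2.
  rewrite xv; apply: (le_trans (ltW vm)).
  by rewrite ler_pM2r // ge_min lexx orbT.
have := enorm_expand x0 v1; have := enorm_expand z0 v2.
have := dist_le Omega_bounded boundary0 (x + v) By.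
have := dist_lip Omega_bounded boundary0 z (x + v).
rewrite dirE xv dotNr sqrrN dz (enormB z) /C exz -dx -sqr_enorm.
have r0' : 0 <= (d x)^-1 by rewrite invr_ge0 dist_ge0.
have r1' : 0 <= (rho - d x)^-1 by rewrite invr_ge0 subr_ge0 ltW.
have q0 : 0 <= enorm v ^+ 2 by exact: sqr_ge0.
have s0 : 0 <= dot v (dir x y) ^+ 2 by exact: sqr_ge0.
move: (enorm v ^+ 2) (dot v (dir x y)) q0 s0 => q s q0 s0.
have := mulr_ge0 q0 r0'; have := mulr_ge0 q0 r1'.
have := mulr_ge0 s0 r0'; have := mulr_ge0 s0 r1'.
rewrite ler_norml; move: (_^-1) (_^-1) => i1 i2; lra.
Qed.

(** Towards a nearest boundary point [d] falls at unit rate; differentiability would make it rise in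
    the opposite direction, impossible at a maximum. *)
Lemma dist_not_differentiable x : Omega x -> d x = rho -> ~ differentiable d x.
Proof.
move=> Ox dx dd; have [y [By dy _]] := nearest_boundary Omega_bounded boundary0 x.
pose v := y - x.
have yx : enorm v = rho by rewrite /v enormB -dy.
have [r r0 rO] := open_enorm Omega_open Ox.
have h1 : 'D_v d x <= - rho.
  apply: (@derive_le _ _ d x v _ 1) => // h h0 h1.
  have : d (x + h *: v) <= (1 - h) * rho.
    apply: (le_trans (dist_le Omega_bounded boundary0 _ By)).
    have -> : x + h *: v - y = (h - 1) *: v.
      by rewrite scalerBl scale1r /v opprB [LHS]addrAC [LHS]addrC.
    by rewrite enormZ yx ler0_norm ?opprB // subr_le0 ltW.
  by rewrite dx; lra.
have h2 : 'D_(- v) d x <= 0.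
  apply: (@derive_le _ _ d x (- v) _ (r / rho)); rewrite ?divr_gt0 // => h h0.
  rewrite ltr_pdivlMr // mul0r subr_le0 dx => hr.
  apply: dist_le_inradius => //; apply: subcl; apply: rO.
  by rewrite addrAC subrr add0r enormZ gtr0_norm // enormN yx.
move: h1 h2 rho0; rewrite !derive_grad // dotNl; lra.
Qed.

(** The singular set is already the high ridge, and taking the closure adds nothing: [d = rho] is a
    closed condition and [d = 0] on the boundary. *)
Lemma cut_locus_eq : cut_locus Omega = high_ridge Omega.
Proof.
have S : singular_set Omega = high_ridge Omega.
  apply/seteqP; split => x [Ox].
    move=> nd; split => //; apply/eqP; rewrite eq_le dist_le_inradius //=; last exact: subcl.
    by rewrite leNgt; apply/negP => /(dist_differentiable Ox).
  by move=> dx; split => //; exact: dist_not_differentiable.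
rewrite /cut_locus S; apply/seteqP; split => x; last first.
  by move=> Mx; split; [exact: subset_closure|have [Ox _] := Mx; exact: subcl].
move=> [cM cx].
have dx : d x = rho.
  have cl : closed [set x | d x = rho].
    rewrite (_ : [set x | d x = rho] = d @^-1` [set rho]) //.
    apply: closed_comp; last exact: closed_eq.
    by move=> z _; exact: continuous_dist.
  have sub : high_ridge Omega `<=` [set x | d x = rho] by move=> z [].
  by have := closure_subset sub cM; rewrite -(closure_id _).1.
split => //; have [//|Bx] := closure_cases Omega_open cx.
by move: rho0; rewrite -dx dist_boundary0 // ltxx.
Qed.

End Neumann.

Theorem theorem22 (R : realType) (n : nat) (Omega : set 'rV[R]_n) (a : R)
  (Omega_nonempty : Omega !=set0)
  (Omega_open : open Omega)
  (Omega_bounded : bounded_set Omega)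
  (Omega_convex : convex_set Omega)
  (Omega_interior_sphere : interior_sphere_condition Omega)
  (inner_ball : exists c p q : 'rV[R]_n,
     [/\ eball c (inradius Omega) `<=` Omega,
         boundary Omega p /\ enorm (p - c) = inradius Omega,
         boundary Omega q /\ enorm (q - c) = inradius Omega
       & p - c = - (q - c)])
  (u : 'rV[R]_n -> R)
  (u_solution : dirichlet_solution Omega u)
  (delta : R) (delta_gt0 : 0 < delta)
  (gradu : 'rV[R]_n -> 'rV[R]_n)
  (u_C1 : C1_up_to_boundary Omega delta u gradu)
  (u_neumann : forall x, boundary Omega x -> enorm (gradu x) = a) :
  [/\ forall x, closure Omega x -> u x = web_function Omega x,
      inradius Omega = a ^+ 3 / 3
    & cut_locus Omega = high_ridge Omega].
Proof.
have [c [p [_ [Bc [Bp pc] _ _]]]] := inner_ball.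
have bd0 : boundary Omega !=set0 by exists p.
have rho0 := inradius_gt0 Omega_open Omega_bounded bd0 Omega_nonempty.
have Oc : Omega c by apply: Bc; rewrite /eball /= subrr enorm0.
have dc : dist_boundary Omega c = inradius Omega.
  apply/eqP; rewrite eq_le dist_le_inradius //=; last exact: subset_closure.
  apply: dist_ge => // y By; rewrite leNgt; apply/negP => yc.
  by apply: (boundary_notin Omega_open By); apply: Bc; rewrite /eball /= enormB.
have aE : a = 4 / 3 * webc * cbrt (inradius Omega).
  apply/eqP; rewrite eq_le; apply/andP; split.
    exact: (neumann_le Omega_nonempty Omega_open Omega_bounded bd0 u_solution
      delta_gt0 u_C1 u_neumann).
  exact: (neumann_ge Omega_nonempty Omega_open Omega_bounded bd0 u_solution
    delta_gt0 u_C1 u_neumann Oc dc Bp pc).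
split.
- move=> x cx.
  have rd : 0 <= inradius Omega - dist_boundary Omega x.
    by rewrite subr_ge0 dist_le_inradius.
  rewrite /web_function -/(@webc R) !powR43E ?(ltW rho0) // -!pow43E.
  exact: (solution_eq_web Omega_nonempty Omega_open Omega_bounded bd0 u_solution
    delta_gt0 u_C1 u_neumann aE Omega_convex).
(* Since [webc = 3/4 cbrt 3], the constant [a] is [cbrt 3 * cbrt rho]. *)
- by rewrite aE webcE !exprMn !cbrtK ?(ltW rho0) //; field.
- exact: (cut_locus_eq Omega_nonempty Omega_open Omega_bounded bd0 u_solution
    delta_gt0 u_C1 u_neumann aE Omega_convex).
Qed.
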